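(* Consider the rank-$r$ directed random graph model with adjacency matrix $A_n$ described in the context. If the growth assumption (X) and the rank-$r$ profile assumption (R) (stated in the context) hold, then there exist $K>0$ and $\eta>1$ such that, for all sufficiently large $n$, $$\mathbb{P}\left(\max\left\{\max_{1\le i\le r}|\lambda_i(A_n)-\lambda_i(\mathbb{E}[A_n])|,\ \max_{r+1\le j\le n}|\lambda_j(A_n)|\right\}\ge K\sqrt{s_n}\right)\le e^{-(\log n)^\eta}.$$
   Context: Model. Fix $r\ge1$ and constants $\theta_1>\theta_2>\dots>\theta_r>0$. For each $n$ let $v_1^\pm,\dots,v_r^\pm\in\mathbb{R}^n$ (depending on $n$) be bi-orthogonal, i.e. $(v_i^+)^tv_j^-=\delta_{ij}$ for $i,j=1,\dots,r$, with $\|v_i^+\|=1$ for each $i$. The matrix $A_n=(a_{xy})_{x,y\in[n]}$ has independent Bernoulli entries with $\mathbb{P}(a_{xy}=1)=p_{x,y}=s_n\sum_{j=1}^r\theta_jv_j^+(x)v_j^-(y)$, where $v(x)$ is the $x$-th entry of $v$ and $s_n>0$. (X) There exists $\xi>4$ such that $\log^\xi(n)\ll s_n\ll n$, where $a_n\ll b_n$ means $a_n/b_n\to0$. (R) For each $1\le i\le r$ the entries of $\sqrt n\,v_i^\pm$ are bounded uniformly in $n$; the quantities $p_{x,y}$ are probabilities (lie in $[0,1]$); and there is a compactly supported probability measure $\rho_r$ on $\mathbb{R}^{2r}$ such that $\frac1n\sum_{x=1}^n\delta_{(\sqrt nv_1^+(x),\dots,\sqrt nv_r^+(x),\sqrt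 nv_1^-(x),\dots,\sqrt nv_r^-(x))}$ converges weakly to $\rho_r$. Eigenvalues of an $n\times n$ complex matrix $M$ are ordered so that $|\lambda_1(M)|\ge\dots\ge|\lambda_n(M)|$. *)

(* Defs.v *)
From HB Require Import structures.
From mathcomp Require Import all_boot all_order all_algebra.
From mathcomp Require Import all_classical all_reals all_analysis.
From mathcomp Require Import complex.

Set Implicit Arguments.
Unset Strict Implicit.
Unset Printing Implicit Defensive.
Import Order.TTheory GRing.Theory Num.Theory.
Import numFieldNormedType.Exports.
Local Open Scope classical_set_scope.
Local Open Scope ring_scope.
Local Open Scope complex_scope.

(* [a] << [b] *)
Definition negligible_wrt (R : realType) (a b : nat -> R) : Prop :=
  (a n / b n) @[n --> \oo] --> (0 : R).

(* The library norm [`|v|] on matrices is the sup norm. *)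
Definition norm2 (R : realType) (n : nat) (v : 'cV[R]_n) : R :=
  Num.sqrt (\sum_(x < n) v x 0 ^+ 2).

Definition cmod (R : realType) (z : R[i]) : R := Normc.normc z.

Notation borel X := (g_sigma_algebraType (@open X)).

Definition weakly_converges (R : realType) (X : ptopologicalType)
    (mu : nat -> {measure set (borel X) -> \bar R})
    (nu : {measure set (borel X) -> \bar R}) : Prop :=
  forall f : X -> R, continuous f -> (exists C : R, forall x, `|f x| <= C) ->
    (\int[mu n]_x (f x)%:E)%E @[n --> \oo] --> (\int[nu]_x (f x)%:E)%E.

Definition compactly_supported (R : realType) (X : ptopologicalType)
    (nu : {measure set (borel X) -> \bar R}) : Prop :=
  exists K : set X, [/\ compact K, closed K & nu (~` K) = 0%E].

Definition empirical (R : realType) d (E : measurableType d) (n : nat)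
    (u : 'I_n -> E) (B : set E) : \bar R :=
  ((n%:R^-1 : R)%:E * \sum_(i < n) \d_(u i) B)%E.

Section empirical_measure.
Context (R : realType) d (E : measurableType d) (n : nat) (u : 'I_n -> E).

Let empirical0 : empirical R u set0 = 0%E.
Proof. by rewrite /empirical big1 ?mule0// => i _; rewrite measure0. Qed.

Let empirical_ge0 B : (0 <= empirical R u B)%E.
Proof. by rewrite mule_ge0 ?lee_fin ?invr_ge0 ?sume_ge0. Qed.

Let empirical_sigma_additive : semi_sigma_additive (empirical R u).
Proof.
move=> F mF tF mUF; rewrite /empirical.
under eq_fun => k.
  rewrite -ge0_sume_distrr; last by move=> i _; exact: sume_ge0.
  rewrite exchange_big/=; over.
apply: cvgeZl => //.
apply: cvg_nnesum => i _; last exact: measure_semi_sigma_additive.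
by apply: nearW => k; exact: sume_ge0.
Qed.

HB.instance Definition _ := isMeasure.Build _ _ _ (empirical R u)
  empirical0 empirical_ge0 empirical_sigma_additive.

End empirical_measure.

Definition mutually_independent (R : realType) d (T : measurableType d)
    (P : probability T R) (I : finType) d' (E : measurableType d')
    (X : I -> {RV P >-> E}) : Prop :=
  forall (J : {set I}) (B : I -> set E), (forall i, measurable (B i)) ->
    P (\bigcap_(i in [set` J]) (X i @^-1` B i)) =
    (\prod_(i in J) P (X i @^-1` B i))%E.

(* Eigenvalues are listed with algebraic multiplicity; ties in modulus may be
   broken in any way. *)
Definition eigenvalues_ordered (R : realType) (n : nat) (M : 'M[R[i]]_n)
    (l : 'I_n -> R[i]) : Prop :=
  char_poly M = \prod_(i < n) ('X - (l i)%:P) /\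
  forall i j : 'I_n, (i <= j)%N -> cmod (l j) <= cmod (l i).

Lemma eigenvalues_ordered_ex (R : realType) (n : nat) (M : 'M[R[i]]_n) :
  exists l, eigenvalues_ordered M l.
Proof.
have [rs Ers] := closed_field_poly_normal (char_poly M).
rewrite (monicP (char_poly_monic M)) scale1r in Ers.
pose ge_mod (x y : R[i]) := cmod y <= cmod x.
have srs : size (sort ge_mod rs) = n.
  apply/eqP; rewrite size_sort -eqSS -(size_char_poly M) Ers.
  by rewrite size_prod_XsubC.
exists (fun i => (sort ge_mod rs)`_i); split => [|i j ij].
  rewrite Ers -(perm_big _ (permEl (perm_sort ge_mod rs)))/=.
  by rewrite (big_nth 0) big_mkord srs.
have tr : transitive ge_mod by move=> y x z xy yz; exact: le_trans yz xy.
have tot : total ge_mod by move=> x y; exact: le_total.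
apply: (sorted_leq_nth tr _ 0 (sort_sorted tot rs)) => //.
- by move=> x; exact: lexx.
- by rewrite inE srs.
- by rewrite inE srs.
Qed.

Definition biorthogonal (R : realType) (r n : nat)
    (vp vm : 'I_r -> 'cV[R]_n) : Prop :=
  forall i j : 'I_r, ((vp i)^T *m vm j) 0 0 = (i == j)%:R.

Definition edge_prob (R : realType) (r n : nat) (theta : 'I_r -> R) (sn : R)
    (vp vm : 'I_r -> 'cV[R]_n) (x y : 'I_n) : R :=
  sn * \sum_(j < r) theta j * vp j x 0 * vm j y 0.

Section random_matrix.
Context (R : realType) d (T : measurableType d) (P : probability T R) (n : nat)
  (a : 'I_n -> 'I_n -> {RV P >-> bool}).

Definition adjacency (w : T) : 'M[R[i]]_n := \matrix_(x, y) (a x y w)%:R.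

Definition expected_adjacency : 'M[R[i]]_n :=
  \matrix_(x, y) (fine 'E_P[fun w => (a x y w)%:R])%:C.

End random_matrix.

(* The hypotheses are imposed for [r <= n] only: there are no [r] pairs of
   biorthogonal vectors in dimension [n < r]. *)
Definition rank_r_digraph (R : realType) (r : nat) (theta : 'I_r -> R)
    (s : nat -> R) (vp vm : forall n, 'I_r -> 'cV[R]_n)
    (d : nat -> measure_display) (T : forall n, measurableType (d n))
    (P : forall n, probability (T n) R)
    (a : forall n, 'I_n -> 'I_n -> {RV (P n) >-> bool}) : Prop :=
  forall n, (r <= n)%N ->
  [/\ 0 < s n,
      biorthogonal (vp n) (vm n),
      forall i, norm2 (vp n i) = 1,
      mutually_independent (fun e : 'I_n * 'I_n => a n e.1 e.2) &
      forall x y, P n [set w | a n x y w = true] =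
                  (edge_prob theta (s n) (vp n) (vm n) x y)%:E].

Definition growth_assumption (R : realType) (s : nat -> R) : Prop :=
  exists xi : R, [/\ 4 < xi,
    negligible_wrt (fun n => ln n%:R `^ xi) s &
    negligible_wrt s (fun n => n%:R)].

Definition profile_point (R : realType) (r n : nat)
    (vp vm : 'I_r -> 'cV[R]_n) (x : 'I_n) : 'rV[R]_(r + r) :=
  Num.sqrt n%:R *: row_mx (\row_i vp i x 0) (\row_i vm i x 0).

Definition profile_assumption (R : realType) (r : nat) (theta : 'I_r -> R)
    (s : nat -> R) (vp vm : forall n, 'I_r -> 'cV[R]_n) : Prop :=
  [/\ exists C : R, forall n, (r <= n)%N -> forall (i : 'I_r) (x : 'I_n),
        `|Num.sqrt n%:R * vp n i x 0| <= C /\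
        `|Num.sqrt n%:R * vm n i x 0| <= C,
      forall n, (r <= n)%N -> forall x y : 'I_n,
        0 <= edge_prob theta (s n) (vp n) (vm n) x y <= 1 &
      exists rho : probability (borel 'rV[R]_(r + r)) R,
        compactly_supported rho /\
        weakly_converges
          (fun n => empirical R
             (profile_point (vp n) (vm n) : 'I_n -> borel 'rV[R]_(r + r)))
          rho].

Definition spectral_deviation (R : realType) (r n : nat)
    (lam : 'M[R[i]]_n -> 'I_n -> R[i]) (A B : 'M[R[i]]_n) : R :=
  Num.max (\big[Num.max/0]_(i < n | (i < r)%N) cmod (lam A i - lam B i))
          (\big[Num.max/0]_(j < n | (r <= j)%N) cmod (lam A j)).

(* Main.v *)
(* Write [A = G + X] with [G = E[A]] of rank [r] and [X] centered: bound the norm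
   of [X] by the trace method, then perturb.

   [E tr (X X^T)^k] is a sum over walks of length [2k] of moments of products of
   entries of [X]; by independence a walk contributes only if it uses each of its
   edges at least twice, and then at most [q] per distinct edge, where [q] bounds
   the entries of [G].  Instead of encoding the walks, one follows a potential of
   the history of the walk, which dominates that weight at the end and whose sum
   over the possible next steps is at most [O(sqrt s)] times its present value.
   This requires [k^4 = O(s)], so [k] may be a power of [log n] larger than 1 as
   soon as [xi > 4], and Markov's inequality gives the stated tail.

   Pairing a row vector [u] such that [u (G + t X) = z u] with the [v_j^+] shows
   that every eigenvalue [z] of [G + t X], [0 <= t <= 1], is either [O(sqrt s)]
   or within [O(sqrt s)] of some [s theta_j].  So the real polynomial
   [t |-> det (z - G - t X)] keeps its sign when [z] is an end of the interval
   around [s theta_j], and [G + X] has a real eigenvalue in each interval.  There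
   is no other large one: an invariant subspace carrying [r + 1] of them contains
   a vector killed by [G], whose image by [G + X] has norm [O(sqrt s)], which the
   determinant of the restriction forbids. *)

From mathcomp Require Import all_boot all_order all_fingroup all_algebra.
From mathcomp Require Import complex.
From mathcomp Require Import ring lra zify.
Set Implicit Arguments.
Unset Strict Implicit.
Unset Printing Implicit Defensive.
Import Order.TTheory GRing.Theory Num.Theory.
Local Open Scope ring_scope.

(** * Walks on the bipartite graph of the entries *)

Section HalfPower.
Variables (R : realFieldType) (k : R).
Hypothesis k1 : 1 <= k.

(** Opening or closing an edge moves the charge of one vertex either by two, which costs or frees
    one factor [k], or between 0 and 1, which is free thanks to the rounding down. *)
Definition halfpow (d : nat) : R := k ^+ d./2.

Lemma halfpow_ge0 d : 0 <= halfpow d.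
Proof. by rewrite exprn_ge0// (le_trans ler01). Qed.

Lemma halfpow_ge1 d : 1 <= halfpow d.
Proof. by rewrite exprn_ege1. Qed.

Lemma halfpowSS d : halfpow d.+2 = k * halfpow d.
Proof. by rewrite /halfpow /= exprS. Qed.

Lemma halfpow_pred_le d : halfpow d.-1 <= halfpow d.
Proof. by rewrite /halfpow ler_weXn2l// half_leq// leq_pred. Qed.

Lemma halfpow_le_pred d : halfpow d <= k * halfpow d.-1.
Proof.
case: d => [|d] /=; first by rewrite {1}/halfpow expr0 mulr_ege1 ?halfpow_ge1.
by rewrite -halfpowSS /halfpow ler_weXn2l// half_leq.
Qed.

End HalfPower.

Section Walks.
Variable n : nat.
Local Notation edge := ('I_n * 'I_n)%type.
Local Notation vertex := (bool * 'I_n)%type.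

(** Vertices are the rows ([false]) and the columns ([true]) of the matrix, and edges are its
    entries, so a walk changes side at each step. *)
Definition mkedge (b : bool) (x y : 'I_n) : edge := if b then (y, x) else (x, y).

Definition endpoint (b : bool) (e : edge) : 'I_n := if b then e.2 else e.1.

Definition once (h : seq edge) (e : edge) : bool := count_mem e h == 1%N.

Definition odeg (h : seq edge) (v : vertex) : nat :=
  #|[set e | once h e & endpoint v.1 e == v.2]|.

Definition nonce (h : seq edge) : nat := #|[set e | once h e]|.

Lemma endpoint_mkedge b x y : endpoint b (mkedge b x y) = x.
Proof. by case: b. Qed.

Lemma endpointN_mkedge b x y : endpoint (~~ b) (mkedge b x y) = y.
Proof. by case: b. Qed.

Lemma mkedge_inj b x : injective (mkedge b x).
Proof. by case: b => y z []. Qed.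

Lemma once_consE h e e' : once (e :: h) e' =
  if e' == e then count_mem e h == 0%N else once h e'.
Proof.
by rewrite /once /= (eq_sym e e'); case: (eqVneq e' e) => [->|_].
Qed.

Lemma card_once_cons (p : pred edge) h e :
  #|[set e' | once (e :: h) e' & p e']| =
  (#|[set e' | once h e' & p e']| + (p e && (count_mem e h == 0)) -
     (p e && once h e))%N.
Proof.
case pe: (p e) => /=; last first.
  rewrite addn0 subn0; apply: eq_card => e'; rewrite !inE once_consE.
  by case: eqP => // ->; rewrite pe !andbF.
rewrite (cardsD1 e [set e' | once (e :: h) e' & p e']).
rewrite (cardsD1 e [set e' | once h e' & p e']) !inE pe !andbT once_consE eqxx.
have -> : [set e' | once (e :: h) e' & p e'] :\ e = [set e' | once h e' & p e'] :\ e.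
  by apply/setP=> e'; rewrite !inE once_consE; case: (eqVneq e' e).
rewrite /once; case: (count_mem e h) => [|[|m]] /=; lia.
Qed.

Lemma odeg_cons h e v : odeg (e :: h) v =
  (odeg h v + ((endpoint v.1 e == v.2) && (count_mem e h == 0)) -
     ((endpoint v.1 e == v.2) && once h e))%N.
Proof. exact: card_once_cons. Qed.

Lemma nonce_cons h e :
  nonce (e :: h) = (nonce h + (count_mem e h == 0%N) - once h e)%N.
Proof.
have nE g : nonce g = #|[set e' | once g e' & xpredT e']|.
  by apply: eq_card => e'; rewrite !inE andbT.
by rewrite !nE card_once_cons.
Qed.

Lemma odeg_once_gt0 h e b : once h e -> (0 < odeg h (b, endpoint b e))%N.
Proof. by move=> he; apply/card_gt0P; exists e; rewrite inE he eqxx. Qed.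

(** This bounds the number of choices for the next vertex: distinct vertices need distinct edges of
    the history. *)
Lemma card_endpoint_le h b (A : {set 'I_n}) :
  (forall y, y \in A -> exists2 e, e \in h & endpoint b e = y) ->
  (#|A| <= size h)%N.
Proof.
move=> hA; rewrite -(size_map (endpoint b)); apply: leq_trans (card_size _).
apply/subset_leq_card/subsetP => y /hA[e he <-]; exact: map_f.
Qed.

Lemma card_odeg_le h b : (#|[set y | (0 < odeg h (b, y))%N]| <= size h)%N.
Proof.
apply: (@card_endpoint_le h b) => y; rewrite inE => /card_gt0P[e].
rewrite inE => /andP[he /eqP eh]; exists e => //.
by rewrite -has_pred1 has_count (eqP he).
Qed.

Lemma card_mkedge_le h b x : (#|[set y | mkedge b x y \in h]| <= size h)%N.
Proof.
apply: (@card_endpoint_le h (~~ b)) => y; rewrite inE => eh.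
by exists (mkedge b x y) => //; rewrite endpointN_mkedge.
Qed.

Lemma card_once_mkedge_le h b x :
  (#|[set y | once h (mkedge b x y)]| <= odeg h (b, x))%N.
Proof.
rewrite -(card_imset _ (@mkedge_inj b x)); apply/subset_leq_card/subsetP.
move=> e /imsetP[y]; rewrite inE => hy ->.
by rewrite inE hy endpoint_mkedge eqxx.
Qed.

Lemma odeg_le_size h v : (odeg h v <= size h)%N.
Proof.
apply: leq_trans (card_size h); apply/subset_leq_card/subsetP => e.
by rewrite inE => /andP[/eqP he _]; rewrite -has_pred1 has_count he.
Qed.

Variables (R : realFieldType) (q t k : R).
Hypotheses (q0 : 0 <= q) (t0 : 0 < t) (k1 : 1 <= k).

(* [t] stands for the square root of [s].  The vertex carrying the walk is
   charged for its [odeg] open edges, every other one for one edge less, the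
   edge through which the walk came.  The half powers make up for the choice of
   the open edge when the walk closes one at a vertex having several. *)
Definition potential (h : seq edge) (u : vertex) : R :=
  q ^+ size (undup h) * t^-1 ^+ nonce h *
  (halfpow k (odeg h u) * \prod_(v | v != u) halfpow k (odeg h v).-1).

Lemma potential_ge0 h u : 0 <= potential h u.
Proof.
rewrite /potential !mulr_ge0 ?halfpow_ge0 ?exprn_ge0 ?invr_ge0 ?(ltW t0)//.
by apply: prodr_ge0 => v _; exact: halfpow_ge0.
Qed.

Lemma potential_nil u : potential [::] u = 1.
Proof.
have o0 v : odeg [::] v = 0%N.
  by apply/eqP; rewrite cards_eq0 -subset0; apply/subsetP => e; rewrite inE.
have n0 : nonce [::] = 0%N.
  by apply/eqP; rewrite cards_eq0 -subset0; apply/subsetP => e; rewrite inE.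
rewrite /potential n0 o0 big1 => [|v _]; last by rewrite o0.
by rewrite /halfpow !expr0 !mulr1.
Qed.

Lemma potential_closed h u : (forall e, ~~ once h e) ->
  q ^+ size (undup h) <= potential h u.
Proof.
move=> hh; rewrite /potential.
have -> : nonce h = 0%N.
  by apply/eqP; rewrite cards_eq0 -subset0; apply/subsetP => e; rewrite inE (negPf (hh e)).
rewrite expr0 mulr1 ler_peMr ?exprn_ge0// mulr_ege1 ?halfpow_ge1//.
elim/big_rec: _ => // v x _ x1; exact/mulr_ege1/x1/halfpow_ge1.
Qed.

Section Step.
Variables (h : seq edge) (b : bool) (x y : 'I_n).
Let e := mkedge b x y.
Let u : vertex := (b, x).
Let w : vertex := (~~ b, y).

Let uw : u != w. Proof. by rewrite /u /w xpair_eqE; case: b. Qed.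

Let rest : R := \prod_(v | (v != u) && (v != w)) halfpow k (odeg h v).-1.

Let rest_ge0 : 0 <= rest.
Proof. by apply: prodr_ge0 => v _; exact: halfpow_ge0. Qed.

Let potE : potential h u = q ^+ size (undup h) * t^-1 ^+ nonce h *
  (halfpow k (odeg h u) * (halfpow k (odeg h w).-1 * rest)).
Proof. by rewrite /potential (bigD1 w)//= eq_sym. Qed.

Let potE' : potential (e :: h) w =
  q ^+ size (undup (e :: h)) * t^-1 ^+ nonce (e :: h) *
  (halfpow k (odeg (e :: h) w) * (halfpow k (odeg (e :: h) u).-1 * rest)).
Proof.
rewrite /potential (bigD1 u)//=; congr (_ * (_ * (_ * _))).
apply: eq_big => [v|v /andP[vw vu]]; first by rewrite andbC.
rewrite odeg_cons; suff -> : (endpoint v.1 e == v.2) = false.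
  by rewrite /= addn0 subn0.
apply/negP => /eqP ev; move: vw vu; rewrite [v]surjective_pairing -ev /e /u /w.
case: (eqVneq v.1 b) => [->|].
  by rewrite endpoint_mkedge eqxx.
move=> vb; have -> : v.1 = ~~ b by move: vb; case: v.1; case: b.
by rewrite endpointN_mkedge eqxx.
Qed.

Let eu : endpoint u.1 e == u.2. Proof. by rewrite endpoint_mkedge. Qed.
Let ew : endpoint w.1 e == w.2. Proof. by rewrite endpointN_mkedge. Qed.

(** A new distinct edge brings [q], and being open it brings [1 / t]. The vertex left keeps its
    charge; the one reached gains two, or goes from 0 to 1 if it had no open edge. *)
Lemma potential_new : e \notin h ->
  potential (e :: h) w = q / t * (if (0 < odeg h w)%N then k else 1) * potential h u.
Proof.
move=> eh; have c0 : count_mem e h == 0%N by rewrite -leqn0 leqNgt -has_count has_pred1.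
have o0 : once h e = false by rewrite /once (eqP c0).
rewrite potE potE' !odeg_cons nonce_cons eu ew c0 o0 /= (negPf eh) /= !subn0 !addn1 !exprS.
have -> : halfpow k (odeg h w).+1 =
    (if (0 < odeg h w)%N then k else 1) * halfpow k (odeg h w).-1.
  by case: (odeg h w) => [|d] /=; rewrite ?mul1r// halfpowSS.
by ring.
Qed.

(** One open edge less frees a factor [t]. The vertex reached keeps its charge; the one left loses
    two, which divides the potential by [k], unless [e] was its only open edge. *)
Lemma potential_close : once h e ->
  potential (e :: h) w * (if (odeg h u == 1)%N then 1 else k) = t * potential h u.
Proof.
move=> o1; have c0 : (count_mem e h == 0%N) = false by move: o1; rewrite /once => /eqP->.
have eh : e \in h by rewrite -has_pred1 has_count; move: o1; rewrite /once => /eqP->.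
have n0 : (0 < nonce h)%N by apply/card_gt0P; exists e; rewrite inE.
have u0 : (0 < odeg h u)%N by move: (odeg_once_gt0 b o1); rewrite endpoint_mkedge.
have w0 : (0 < odeg h w)%N by move: (odeg_once_gt0 (~~ b) o1); rewrite endpointN_mkedge.
rewrite potE potE' !odeg_cons nonce_cons eu ew c0 o1 /= eh /= !addn0 !subn1.
have tn : t^-1 ^+ nonce h = t^-1 * t^-1 ^+ (nonce h).-1.
  by rewrite -exprS prednK.
have fu : halfpow k (odeg h u) =
    (if (odeg h u == 1)%N then 1 else k) * halfpow k (odeg h u).-1.-1.
  by case: (odeg h u) u0 => [|[|d]] //= _; rewrite ?mul1r// halfpowSS.
rewrite tn fu; set a := (if _ then _ else _).
have tt : t * t^-1 = 1 by rewrite divff// gt_eqF.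
by rewrite -[LHS]mul1r -tt; ring.
Qed.

(** No edge is opened or closed; only the place of the walk changes, which raises the charge of [w]
    by at most one and does not raise that of [u]. *)
Lemma potential_again : e \in h -> ~~ once h e ->
  potential (e :: h) w <= k * potential h u.
Proof.
move=> eh o1; have c0 : (count_mem e h == 0%N) = false.
  by apply/negbTE; rewrite -lt0n -has_count has_pred1.
rewrite potE potE' !odeg_cons nonce_cons eu ew c0 (negPf o1) /= eh /= !addn0 !subn0.
rewrite [leRHS]mulrCA ler_wpM2l ?mulr_ge0 ?exprn_ge0 ?invr_ge0 ?(ltW t0)//.
apply: (@le_trans _ _ ((k * halfpow k (odeg h w).-1) * (halfpow k (odeg h u) * rest))).
  by rewrite ler_pM ?mulr_ge0 ?halfpow_ge0 ?halfpow_le_pred// ler_wpM2r ?halfpow_pred_le.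
by rewrite le_eqVlt; apply/orP; left; apply/eqP; ring.
Qed.

End Step.

Lemma sumr_le_card (A : {set 'I_n}) (F : 'I_n -> R) (c : R) (m : nat) :
  0 <= c -> (#|A| <= m)%N -> (forall y, y \in A -> F y <= c) ->
  \sum_(y in A) F y <= m%:R * c.
Proof.
move=> c0 Am FA; apply: (@le_trans _ _ (\sum_(y in A) c)); first exact: ler_sum.
by rewrite sumr_const -[leLHS]mulr_natl ler_wpM2r// ler_nat.
Qed.

(** A new edge offers at most [n] targets at cost [q / t], and at most [l] with open edges at cost
    [k * q / t]. Closing is a single choice at cost [t], or at most [l] choices at cost [t / k].
    Reusing an edge is at most [l] choices at cost [k]. The four totals are at most [C * t], [t],
    [t] and [t]. *)
Lemma potential_step (C : R) (l : nat) h b x :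
  (size h <= l)%N -> l%:R <= k -> l%:R * k <= t ->
  n%:R * q <= C * t ^+ 2 -> l%:R * k * q <= t ^+ 2 ->
  \sum_y potential (mkedge b x y :: h) (~~ b, y) <= (C + 3) * t * potential h (b, x).
Proof.
move=> hl lk lkt nq lkq; set P := potential h (b, x).
have PE : potential h (b, x) = P by [].
have P0 : 0 <= P by exact: potential_ge0.
clearbody P.
have tP0 : 0 <= t * P by rewrite mulr_ge0// ltW.
have tD : t ^+ 2 / t = t by rewrite expr2 mulfK// gt_eqF.
pose N := [set y | (mkedge b x y \notin h) && (0 < odeg h (~~ b, y))%N].
pose N0 := [set y | (mkedge b x y \notin h) && (odeg h (~~ b, y) == 0)%N].
pose S1 := [set y | once h (mkedge b x y)].
pose S2 := [set y | (mkedge b x y \in h) && ~~ once h (mkedge b x y)].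
set F := fun y => potential (mkedge b x y :: h) (~~ b, y).
(* In order: an edge never used before, to a vertex without or with open
   edges; an edge used once; an edge used at least twice. *)
have split4 : \sum_y F y = \sum_(y in N0) F y + \sum_(y in N) F y +
    \sum_(y in S1) F y + \sum_(y in S2) F y.
  rewrite (bigID (fun y => mkedge b x y \in h)) /= addrC -!addrA.
  rewrite (bigID (fun y => odeg h (~~ b, y) == 0)%N) /= -addrA.
  congr (_ + (_ + _)).
  - by apply: eq_bigl => y; rewrite !inE.
  - by apply: eq_bigl => y; rewrite !inE lt0n.
  rewrite (bigID (fun y => once h (mkedge b x y))) /=; congr (_ + _).
  - apply: eq_bigl => y; rewrite !inE; case o: (once _ _); rewrite ?andbF// andbT.
    by rewrite -has_pred1 has_count (eqP o).
  - by apply: eq_bigl => y; rewrite !inE.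
have qtP0 : 0 <= q / t * P by rewrite mulr_ge0// mulr_ge0// invr_ge0 ltW.
have H0 : \sum_(y in N0) F y <= C * t * P.
  apply: (@le_trans _ _ (n%:R * (q / t * P))).
    apply: sumr_le_card => //; first by rewrite -[X in (_ <= X)%N]card_ord max_card.
    move=> y; rewrite inE => /andP[eh /eqP w0].
    by rewrite /F potential_new// PE w0 /= mulr1.
  rewrite !mulrA ler_wpM2r//.
  apply: (@le_trans _ _ (C * t ^+ 2 / t)).
    by rewrite ler_wpM2r ?invr_ge0 ?(ltW t0).
  by rewrite -mulrA tD.
have H1 : \sum_(y in N) F y <= t * P.
  apply: (@le_trans _ _ (l%:R * (k * (q / t * P)))).
    apply: sumr_le_card => //; first by rewrite mulr_ge0// (le_trans ler01).
      apply: leq_trans hl; apply: leq_trans (card_odeg_le h (~~ b)).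
      by apply/subset_leq_card/subsetP => y; rewrite !inE => /andP[].
    move=> y; rewrite inE => /andP[eh w0].
    by rewrite /F potential_new// PE w0 (mulrC (q / t)) mulrA.
  rewrite (_ : _ * _ = l%:R * k * q / t * P); last by ring.
  by rewrite ler_wpM2r// -[leRHS]tD ler_wpM2r// invr_ge0 ltW.
have H2 : \sum_(y in S1) F y <= t * P.
  have k0 : 0 < k by rewrite (lt_le_trans ltr01).
  case: (eqVneq (odeg h (b, x)) 1%N) => d1.
    rewrite -[leRHS]mul1r; apply: (@sumr_le_card _ _ _ 1%N) => //.
      by rewrite -d1 card_once_mkedge_le.
    by move=> y; rewrite inE => o1; rewrite -PE -(potential_close o1) d1 eqxx mulr1.
  apply: (@le_trans _ _ (l%:R * (t * P / k))); last first.
    by rewrite mulrCA ler_piMr// ler_pdivrMr// mul1r.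
  apply: sumr_le_card.
  - by rewrite mulr_ge0// invr_ge0 ltW.
  - apply: leq_trans (card_once_mkedge_le h b x) _.
    exact: leq_trans (odeg_le_size _ _) hl.
  move=> y; rewrite inE => o1; rewrite -PE -(potential_close o1) (negPf d1).
  by rewrite mulfK// gt_eqF.
have H3 : \sum_(y in S2) F y <= t * P.
  apply: (@le_trans _ _ (l%:R * (k * P))).
    apply: sumr_le_card; first by rewrite mulr_ge0// (le_trans ler01).
      apply: leq_trans hl; apply: leq_trans (card_mkedge_le h b x).
      by apply/subset_leq_card/subsetP => y; rewrite !inE => /andP[].
    by move=> y; rewrite inE => /andP[eh o1]; rewrite -PE; exact: potential_again.
  by rewrite mulrA ler_wpM2r.
rewrite split4 (_ : (C + 3) * t * P = C * t * P + t * P + t * P + t * P); last by ring.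
by rewrite !lerD.
Qed.

(** For even [m] and [b = false] this is a power of [X *m X^T]. Odd lengths and both sides are
    included so that walks can be extended one edge at a time. *)
Fixpoint altprod (X : 'M[R]_n) (m : nat) (b : bool) : 'M[R]_n :=
  if m is m'.+1 then (if b then X^T else X) *m altprod X m' (~~ b) else 1%:M.

(** Induction on the number of remaining steps: expanding the first factor of the product moves one
    edge into the history [h], and [potential_step] pays for the sum over its end. The law enters
    only through its mixed moments. *)
Lemma altprod_moment (W : finType) (mu : W -> R) (X : W -> 'M[R]_n)
    (C : R) (l : nat) :
  l%:R <= k -> l%:R * k <= t -> 0 <= C ->
  n%:R * q <= C * t ^+ 2 -> l%:R * k * q <= t ^+ 2 ->
  (forall h : seq edge, `|\sum_w mu w * \prod_(e <- h) X w e.1 e.2| <=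
     if [forall e, ~~ once h e] then q ^+ size (undup h) else 0) ->
  forall m h b x v, (size h + m <= l)%N ->
  `|\sum_w mu w * (\prod_(e <- h) X w e.1 e.2) * altprod (X w) m b x v| <=
  ((C + 3) * t) ^+ m * potential h (b, x).
Proof.
move=> lk lkt C0 nq lkq Hmu; elim=> [|m IH] h b x v hl /=.
  rewrite expr0 mul1r mxE; under eq_bigr do rewrite mulrC.
  rewrite -mulr_sumr normrM normr_nat.
  apply: (@le_trans _ _ (`|\sum_w mu w * \prod_(e <- h) X w e.1 e.2|)).
    by rewrite ler_piMl// lern1 leq_b1.
  apply: le_trans (Hmu h) _; case: ifP => [/forallP|_].
    exact: potential_closed.
  exact: potential_ge0.
rewrite (_ : \sum_w _ = \sum_y \sum_w mu w *
    (\prod_(e <- mkedge b x y :: h) X w e.1 e.2) * altprod (X w) m (~~ b) y v); last first.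
  rewrite exchange_big /=; apply: eq_bigr => w _.
  rewrite mxE mulr_sumr; apply: eq_bigr => y _; rewrite big_cons.
  have -> : X w (mkedge b x y).1 (mkedge b x y).2 = (if b then (X w)^T else X w) x y.
    by case: b; rewrite ?mxE.
  by ring.
apply: le_trans (ler_norm_sum _ _ _) _.
apply: (@le_trans _ _ (\sum_y ((C + 3) * t) ^+ m * potential (mkedge b x y :: h) (~~ b, y))).
  by apply: ler_sum => y _; apply: IH => /=; lia.
rewrite -mulr_sumr exprSr -mulrA ler_wpM2l ?exprn_ge0 ?mulr_ge0 ?(ltW t0) ?addr_ge0//.
apply: (@potential_step C l) => //; lia.
Qed.

End Walks.

(** * Moments of centered Bernoulli matrices *)

Section BernoulliMoments.
Variables (R : realFieldType) (n : nat) (p : 'I_n * 'I_n -> R).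
Hypothesis p01 : forall e, 0 <= p e <= 1.

Definition bernoulli_weight (c : {ffun 'I_n * 'I_n -> bool}) : R :=
  \prod_e (if c e then p e else 1 - p e).

Definition centered (c : {ffun 'I_n * 'I_n -> bool}) : 'M[R]_n :=
  \matrix_(x, y) ((c (x, y))%:R - p (x, y)).

Lemma bernoulli_weight_ge0 c : 0 <= bernoulli_weight c.
Proof.
apply: prodr_ge0 => e _; have /andP[p0 p1] := p01 e.
by case: ifP => // _; rewrite subr_ge0.
Qed.

(** Powers of numbers in [[0, 1]] decrease, so every moment of order at least 2 is bounded by the
    variance [p (1 - p)]. *)
Lemma centered_moment_le e (m : nat) :
  `|\sum_(b : bool) (if b then p e else 1 - p e) * (b%:R - p e) ^+ m.+2| <= p e.
Proof.
have /andP[p0 p1] := p01 e; rewrite big_bool /= sub0r.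
have q0 : 0 <= 1 - p e by rewrite subr_ge0.
have qm : (1 - p e) ^+ m.+1 <= 1 - p e.
  by rewrite exprS ler_piMr// exprn_ile1// lerBlDr lerDl.
have pm : p e ^+ m.+1 <= p e by rewrite exprS ler_piMr// exprn_ile1.
apply: le_trans (ler_normD _ _) _. rewrite (normrM (p e)) (normrM _ ((- p e) ^+ _)) !normrX normrN (ger0_norm p0) (ger0_norm q0).
rewrite !(exprS _ m.+1).
have h1 : p e * ((1 - p e) * (1 - p e) ^+ m.+1) <= p e * ((1 - p e) * (1 - p e)).
  by rewrite ler_wpM2l// ler_wpM2l.
have h2 : (1 - p e) * (p e * p e ^+ m.+1) <= (1 - p e) * (p e * p e).
  by rewrite ler_wpM2l// ler_wpM2l.
by apply: le_trans (lerD h1 h2) _; nra.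
Qed.

(** By independence the moment is a product over all edges, each with order its multiplicity in [h]:
    order 0 gives 1, order 1 gives 0, and higher orders give at most [q]. *)
Lemma centered_monomial_moment (q : R) (h : seq ('I_n * 'I_n)) :
  (forall e, p e <= q) ->
  `|\sum_c bernoulli_weight c * \prod_(e <- h) centered c e.1 e.2| <=
     if [forall e, ~~ once h e] then q ^+ size (undup h) else 0.
Proof.
move=> pq; pose F e (b : bool) :=
  (if b then p e else 1 - p e) * (b%:R - p e) ^+ count_mem e h.
have -> : \sum_c bernoulli_weight c * \prod_(e <- h) centered c e.1 e.2 =
    \prod_e \sum_(b : bool) F e b.
  rewrite bigA_distr_bigA /=; apply: eq_bigr => c _.
  rewrite /F big_split /=; congr (_ * _).
  under eq_bigr => e _ do rewrite mxE -surjective_pairing.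
  clear F; elim: h => [|e h IH] /=; first by rewrite big_nil big1.
  rewrite big_cons IH (bigD1 e)//= [RHS](bigD1 e)//= eqxx exprS mulrA; congr (_ * _).
  by apply: eq_bigr => e' /negPf ee; rewrite eq_sym ee.
rewrite normr_prod; case: ifPn => [/forallP oh|].
  have -> : q ^+ size (undup h) = \prod_e (if e \in h then q else 1).
    rewrite -big_mkcond /= prodr_const; congr (_ ^+ _).
    rewrite -(card_uniqP (undup_uniq h)).
    by apply: eq_card => e; rewrite mem_undup.
  apply: ler_prod => e _; rewrite normr_ge0 /=; have := oh e; rewrite /once /F.
  have := has_pred1 e h; rewrite has_count.
  case: (count_mem e h) => [|[|m]] //= <- _.
    by rewrite big_bool /= !expr0 !mulr1 addrCA subrr addr0 normr1.
  exact: le_trans (centered_moment_le e m) (pq e).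
rewrite negb_forall => /existsP[e]; rewrite negbK => /eqP he.
rewrite (bigD1 e)//= /F he big_bool /= !expr1.
have -> : p e * (1 - p e) + (1 - p e) * (0 - p e) = 0 by ring.
by rewrite normr0 mul0r.
Qed.

(** The walk bound is used with [k = l], the least value it allows, and with the empty history,
    whose potential is 1. *)
Lemma altprod_weighted_trace (q C t : R) (l : nat) :
  (0 < n)%N -> (forall e, p e <= q) -> 0 < t -> 0 <= C -> (0 < l)%N ->
  l%:R ^+ 2 <= t -> n%:R * q <= C * t ^+ 2 -> l%:R ^+ 2 * q <= t ^+ 2 ->
  \sum_c bernoulli_weight c * \tr (altprod (centered c) l false) <=
  n%:R * ((C + 3) * t) ^+ l.
Proof.
move=> n0 pq t0 C0 l0 lt nq lq.
have q0 : 0 <= q.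
  have e0 := Ordinal n0; have /andP[p0 _] := p01 (e0, e0).
  exact: le_trans p0 (pq _).
have l1 : 1 <= l%:R :> R by rewrite ler1n.
rewrite (_ : \sum_c _ = \sum_x \sum_c bernoulli_weight c *
    (\prod_(e <- [::]) centered c e.1 e.2) * altprod (centered c) l false x x); last first.
  rewrite exchange_big; apply: eq_bigr => c _; rewrite /mxtrace mulr_sumr.
  by apply: eq_bigr => x _; rewrite big_nil mulr1.
apply: (@le_trans _ _ (\sum_(x < n) ((C + 3) * t) ^+ l)); last first.
  by rewrite sumr_const card_ord -[leLHS]mulr_natl.
apply: ler_sum => x _; apply: le_trans (ler_norm _) _.
have := @altprod_moment n R q t l%:R q0 t0 l1 _ bernoulli_weight centered C l.
move=> /(_ (lexx _)); rewrite -expr2 => /(_ lt C0 nq lq).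
move=> /(_ (fun h => centered_monomial_moment h pq) l [::] false x x (leqnn _)).
by rewrite potential_nil mulr1.
Qed.

(** Markov's inequality. Nonnegativity of the trace is assumed because it can fail for odd [l]. *)
Lemma altprod_trace_tail (q C t K : R) (l : nat) :
  (0 < n)%N -> (forall e, p e <= q) -> 0 < t -> 0 <= C -> (0 < l)%N ->
  l%:R ^+ 2 <= t -> n%:R * q <= C * t ^+ 2 -> l%:R ^+ 2 * q <= t ^+ 2 ->
  (forall c, 0 <= \tr (altprod (centered c) l false)) -> 0 < K ->
  \sum_(c | (K * t) ^+ l < \tr (altprod (centered c) l false)) bernoulli_weight c <=
  n%:R * ((C + 3) / K) ^+ l.
Proof.
move=> n0 pq t0 C0 l0 lt nq lq tr0 K0.
have Kt0 : 0 < (K * t) ^+ l by rewrite exprn_gt0// mulr_gt0.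
have -> : n%:R * ((C + 3) / K) ^+ l = n%:R * ((C + 3) * t) ^+ l / (K * t) ^+ l.
  rewrite -mulrA -expr_div_n; congr (_ * _ ^+ _); field.
  by rewrite !gt_eqF.
rewrite ler_pdivlMr//; apply: le_trans (altprod_weighted_trace n0 pq t0 C0 l0 lt nq lq).
rewrite [leRHS](bigID (fun c => (K * t) ^+ l < \tr (altprod (centered c) l false))) /=.
rewrite mulr_suml -[leLHS]addr0 lerD//.
  by apply: ler_sum => c /ltW ?; rewrite ler_wpM2l// bernoulli_weight_ge0.
by apply: sumr_ge0 => c _; rewrite mulr_ge0// bernoulli_weight_ge0.
Qed.

End BernoulliMoments.

(** * From the trace to the operator norm *)

(** Lagrange's identity: twice the defect is the double sum of the squares of
    [a i * b j - a j * b i]. *)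
Lemma sum_cauchy_schwarz (R : realFieldType) (I : finType) (a b : I -> R) :
  (\sum_i a i * b i) ^+ 2 <= (\sum_i a i ^+ 2) * (\sum_i b i ^+ 2).
Proof.
have : 0 <= \sum_i \sum_j (a i * b j - a j * b i) ^+ 2.
  by apply: sumr_ge0 => i _; apply: sumr_ge0 => j _; exact: sqr_ge0.
have -> : \sum_i \sum_j (a i * b j - a j * b i) ^+ 2 =
    ((\sum_i a i ^+ 2) * (\sum_i b i ^+ 2) - (\sum_i a i * b i) ^+ 2) *+ 2.
  pose S := \sum_i \sum_j a i ^+ 2 * b j ^+ 2.
  have -> : (\sum_i a i ^+ 2) * (\sum_i b i ^+ 2) = S.
    by rewrite mulr_suml; apply: eq_bigr => i _; rewrite mulr_sumr.
  have SE : \sum_i \sum_j a j ^+ 2 * b i ^+ 2 = S by rewrite exchange_big.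
  have -> : (\sum_i a i * b i) ^+ 2 = \sum_i \sum_j (a i * b i) * (a j * b j).
    by rewrite expr2 mulr_suml; apply: eq_bigr => i _; rewrite mulr_sumr.
  set D := \sum_i \sum_j (a i * b i) * (a j * b j).
  rewrite (_ : (S - D) *+ 2 = S + S - D *+ 2); last by ring.
  rewrite -{2}SE -big_split -sumrMnl -sumrB; apply: eq_bigr => i _.
  rewrite -big_split -sumrMnl -sumrB; apply: eq_bigr => j _ /=; ring.
by rewrite pmulrn_lge0// subr_ge0.
Qed.

Section TraceBound.
Variables (R : realFieldType) (n : nat) (X : 'M[R]_n).

Local Notation gram j := (altprod X j.*2 false).

Definition sqnorm m (u : 'rV[R]_m) : R := \sum_x u 0 x ^+ 2.

Lemma sqnormE m (u : 'rV[R]_m) : sqnorm u = (u *m u^T) 0 0.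
Proof. by rewrite mxE; apply: eq_bigr => x _; rewrite mxE expr2. Qed.

Lemma sqnorm_ge0 m (u : 'rV[R]_m) : 0 <= sqnorm u.
Proof. by apply: sumr_ge0 => x _; exact: sqr_ge0. Qed.

Lemma gramS j : gram j.+1 = X *m X^T *m gram j.
Proof. by rewrite doubleS /= mulmxA. Qed.

Lemma gramD i j : gram (i + j) = gram i *m gram j.
Proof.
elim: i => [|i IH]; first by rewrite /= mul1mx.
by rewrite addSn !gramS IH mulmxA.
Qed.

Lemma gram_sym j : (gram j)^T = gram j.
Proof.
elim: j => [|j IH]; first by rewrite /= trmx1.
have g1 : gram 1 = X *m X^T by rewrite gramS /= mulmx1.
by rewrite {1}gramS !trmx_mul trmxK IH -[in RHS]addn1 gramD g1.
Qed.

Lemma gram_double j : gram j.*2 = gram j *m (gram j)^T.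
Proof. by rewrite gram_sym -gramD addnn. Qed.

Lemma gram_trace j : \tr (gram j.*2) = \sum_x \sum_y (gram j x y) ^+ 2.
Proof.
rewrite gram_double /mxtrace; apply: eq_bigr => x _.
by rewrite mxE; apply: eq_bigr => y _; rewrite mxE expr2.
Qed.

Lemma gram_form_double j (u : 'rV[R]_n) :
  (u *m gram j.*2 *m u^T) 0 0 = sqnorm (u *m gram j).
Proof. by rewrite gram_double sqnormE trmx_mul !mulmxA. Qed.

Lemma gram_form_sqr_le j (u : 'rV[R]_n) :
  (u *m gram j *m u^T) 0 0 ^+ 2 <= sqnorm u * (u *m gram j.*2 *m u^T) 0 0.
Proof.
rewrite gram_form_double mxE mulrC.
under eq_bigr => x _ do rewrite [u^T _ _]mxE.
exact: sum_cauchy_schwarz.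
Qed.

Lemma gram_form_le j (u : 'rV[R]_n) :
  (u *m gram j.*2 *m u^T) 0 0 <= sqnorm u * \tr (gram j.*2).
Proof.
rewrite gram_form_double gram_trace exchange_big /= mulr_sumr.
by apply: ler_sum => y _; rewrite mxE; exact: sum_cauchy_schwarz.
Qed.

(** Cauchy-Schwarz says that the square of the Rayleigh quotient of [gram j] is at most that of
    [gram j.*2]; iterating it replaces the diagonalization of [X *m X^T]. Clearing denominators
    gives this form. *)
Lemma sqnorm_mul_pow_le m (u : 'rV[R]_n) :
  sqnorm (u *m X) ^+ (2 ^ m) * sqnorm u <=
  sqnorm u ^+ (2 ^ m) * (u *m gram (2 ^ m) *m u^T) 0 0.
Proof.
elim: m => [|m IH].
  by rewrite !expr1 gramS /= mulmx1 sqnormE trmx_mul !mulmxA mulrC.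
have [->|u0] := eqVneq (sqnorm u) 0.
  by rewrite mulr0 expr0n gtn_eqF ?expn_gt0// mul0r.
have {u0}u0 : 0 < sqnorm u by rewrite lt_def u0 sqnorm_ge0.
rewrite -(ler_pM2r u0).
apply: (@le_trans _ _ ((sqnorm (u *m X) ^+ (2 ^ m) * sqnorm u) ^+ 2)).
  by rewrite exprMn -exprM -expnSr expr2 mulrA.
have h0 : 0 <= sqnorm (u *m X) ^+ (2 ^ m) * sqnorm u.
  by rewrite mulr_ge0// ?exprn_ge0// sqnorm_ge0.
apply: (@le_trans _ _ ((sqnorm u ^+ (2 ^ m) * (u *m gram (2 ^ m) *m u^T) 0 0) ^+ 2)).
  by rewrite ler_sqr ?nnegrE//; exact: le_trans IH.
rewrite exprMn -exprM -expnSr -mulrA ler_wpM2l ?exprn_ge0 ?sqnorm_ge0//.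
by rewrite mulrC expnS mul2n gram_form_sqr_le.
Qed.

(** The index is even, so the matrix is [M *m M^T] with [M = gram (2 ^ m)], and Cauchy-Schwarz
    bounds its quadratic form by its trace. A root of order [2 ^ m.+1] then gives the operator
    norm. *)
Lemma sqnorm_mul_le_trace (b : R) m (u : 'rV[R]_n) :
  0 <= b -> \tr (gram (2 ^ m.+1)) <= b ^+ (2 ^ m.+1).*2 ->
  sqnorm (u *m X) <= b ^+ 2 * sqnorm u.
Proof.
move=> b0 trb; have := sqnorm_mul_pow_le m.+1 u.
have [u0 _|u0] := eqVneq (sqnorm u) 0.
  have u00 : u = 0.
    apply/rowP => x; rewrite mxE; apply/eqP; rewrite -sqrf_eq0; apply/eqP.
    move: u0 => /psumr_eq0P; apply => // y _; exact: sqr_ge0.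
  by rewrite u00 mul0mx /sqnorm big1 ?mulr0// => x _; rewrite mxE expr0n.
have {u0}u0 : 0 < sqnorm u by rewrite lt_def u0 sqnorm_ge0.
move=> h.
rewrite -(@ler_pXn2r _ (2 ^ m.+1)) ?expn_gt0 ?nnegrE ?sqnorm_ge0//; last first.
  by rewrite mulr_ge0 ?sqnorm_ge0 ?exprn_ge0.
rewrite -(ler_pM2r u0); apply: le_trans h _.
rewrite exprMn mulrAC mulrC ler_wpM2r ?exprn_ge0 ?sqnorm_ge0//.
rewrite expnS mul2n; apply: le_trans (gram_form_le _ _) _.
rewrite mulrC ler_wpM2r ?sqnorm_ge0//.
have e : (2 ^ m).*2 = (2 ^ m.+1)%N by rewrite expnS mul2n.
by rewrite e -exprM mul2n.
Qed.

End TraceBound.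

(** * Norms of complex row vectors *)

Local Notation toC M := (map_mx (real_complex _) M).

Section Normc.
Variable R : rcfType.
Implicit Types (x y : R[i]).
Local Notation normc := (@Normc.normc R).

Lemma normcE x : (normc x)%:C%C = `|x|.
Proof. by case: x. Qed.

Lemma normc_ge0 x : 0 <= normc x.
Proof. by case: x => a b; exact: sqrtr_ge0. Qed.

Lemma normc_sqr x : normc x ^+ 2 = complex.Re x ^+ 2 + complex.Im x ^+ 2.
Proof. by case: x => a b /=; rewrite sqr_sqrtr// addr_ge0 ?sqr_ge0. Qed.

Lemma normc_real (a : R) : normc a%:C%C = `|a|.
Proof. by rewrite /= expr0n addr0 sqrtr_sqr. Qed.

Lemma normcB x y : normc (x - y) = normc (y - x).
Proof. by rewrite -(normcN (x - y)) opprB. Qed.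

Lemma normc_sum (I : Type) (r : seq I) (P : pred I) (F : I -> R[i]) :
  normc (\sum_(i <- r | P i) F i) <= \sum_(i <- r | P i) normc (F i).
Proof.
elim/big_rec2: _ => [|i y x _ xy]; first by rewrite Normc.normc0.
by apply: le_trans (le_normcD _ _) _; rewrite lerD2l.
Qed.

Lemma normc_prod (I : Type) (r : seq I) (P : pred I) (F : I -> R[i]) :
  normc (\prod_(i <- r | P i) F i) = \prod_(i <- r | P i) normc (F i).
Proof. exact: (big_morph normc (@Normc.normcM R) (@Normc.normc1 R)). Qed.

End Normc.

Section ComplexNorm.
Variable R : rcfType.
Local Notation C := R[i].
Local Notation normc := (@Normc.normc R).

Definition csqnorm m (u : 'rV[C]_m) : R := \sum_x normc (u 0 x) ^+ 2.
Definition cnorm m (u : 'rV[C]_m) : R := Num.sqrt (csqnorm u).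

Lemma csqnorm_ge0 m (u : 'rV[C]_m) : 0 <= csqnorm u.
Proof. by apply: sumr_ge0 => x _; exact: sqr_ge0. Qed.

Lemma cnorm_ge0 m (u : 'rV[C]_m) : 0 <= cnorm u.
Proof. exact: sqrtr_ge0. Qed.

Lemma cnorm_sqr m (u : 'rV[C]_m) : cnorm u ^+ 2 = csqnorm u.
Proof. by rewrite sqr_sqrtr ?csqnorm_ge0. Qed.

Lemma cnorm_gt0 m (u : 'rV[C]_m) : u != 0 -> 0 < cnorm u.
Proof.
move=> u0; rewrite lt_def cnorm_ge0 andbT; apply: contra u0.
rewrite sqrtr_eq0 => u0; apply/eqP/rowP => x; rewrite mxE.
apply: Normc.eq0_normc; apply/eqP; rewrite -sqrf_eq0; apply/eqP.
have /psumr_eq0P : csqnorm u = 0 by apply/eqP; rewrite eq_le u0 csqnorm_ge0.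
by apply => // y _; exact: sqr_ge0.
Qed.

Lemma cnormZ m a (u : 'rV[C]_m) : cnorm (a *: u) = normc a * cnorm u.
Proof.
rewrite /cnorm /csqnorm; under eq_bigr do rewrite mxE Normc.normcM exprMn.
by rewrite -mulr_sumr sqrtrM ?sqr_ge0// sqrtr_sqr ger0_norm ?normc_ge0.
Qed.

Lemma cnorm_pairing m (a b : 'I_m -> C) :
  normc (\sum_x a x * b x) <=
  Num.sqrt (\sum_x normc (a x) ^+ 2) * Num.sqrt (\sum_x normc (b x) ^+ 2).
Proof.
have s0 (c : 'I_m -> C) : 0 <= \sum_x normc (c x) ^+ 2.
  by apply: sumr_ge0 => x _; exact: sqr_ge0.
apply: le_trans (normc_sum _ _ _) _; rewrite -sqrtrM//.
under eq_bigr do rewrite Normc.normcM.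
rewrite -[leLHS]ger0_norm; last by apply: sumr_ge0 => x _; rewrite mulr_ge0 ?normc_ge0.
by rewrite -sqrtr_sqr ler_sqrt ?mulr_ge0// sum_cauchy_schwarz.
Qed.

Lemma cnormD m (u v : 'rV[C]_m) : cnorm (u + v) <= cnorm u + cnorm v.
Proof.
rewrite -ler_sqr ?nnegrE ?addr_ge0 ?cnorm_ge0// sqrrD !cnorm_sqr.
apply: (@le_trans _ _ (\sum_x (normc (u 0 x) + normc (v 0 x)) ^+ 2)).
  apply: ler_sum => x _; rewrite ler_sqr ?nnegrE ?addr_ge0 ?normc_ge0//.
  by rewrite mxE le_normcD.
under eq_bigr do rewrite sqrrD.
rewrite !big_split /= lerD2r lerD2l -mulr2n lerMn2r /=.
rewrite /cnorm -sqrtrM ?csqnorm_ge0//.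
rewrite -[leLHS]ger0_norm; last by apply: sumr_ge0 => x _; rewrite mulr_ge0 ?normc_ge0.
by rewrite -sqrtr_sqr ler_sqrt ?mulr_ge0 ?csqnorm_ge0// sum_cauchy_schwarz.
Qed.

Lemma cnorm0 m : cnorm (0 : 'rV[C]_m) = 0.
Proof. by rewrite -(scale0r (0 : 'rV[C]_m)) cnormZ Normc.normc0 mul0r. Qed.

Lemma cnorm_sum m (I : Type) (r : seq I) (P : pred I) (F : I -> 'rV[C]_m) :
  cnorm (\sum_(i <- r | P i) F i) <= \sum_(i <- r | P i) cnorm (F i).
Proof.
elim/big_rec2: _ => [|i y x _ xy]; first by rewrite cnorm0.
by apply: le_trans (cnormD _ _) _; rewrite lerD2l.
Qed.

Lemma csqnormE m (u : 'rV[C]_m) :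
  csqnorm u = sqnorm (map_mx (@complex.Re R) u) + sqnorm (map_mx (@complex.Im R) u).
Proof. by rewrite -big_split; apply: eq_bigr => x _; rewrite !mxE normc_sqr. Qed.

(** A real matrix acts separately on real and imaginary parts, so a real norm bound passes to
    complex vectors with the same constant. *)
Lemma cnorm_mul_real m (X : 'M[R]_m) (b : R) (u : 'rV[C]_m) : 0 <= b ->
  (forall v, sqnorm (v *m X) <= b ^+ 2 * sqnorm v) ->
  cnorm (u *m toC X) <= b * cnorm u.
Proof.
move=> b0 hX; rewrite -ler_sqr ?nnegrE ?mulr_ge0 ?cnorm_ge0// exprMn !cnorm_sqr.
have -> : csqnorm (u *m toC X) = sqnorm (map_mx (@complex.Re R) u *m X) +
    sqnorm (map_mx (@complex.Im R) u *m X).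
  rewrite csqnormE; congr (_ + _); congr (sqnorm _); apply/rowP => y; rewrite !mxE.
    rewrite (raddf_sum (@complex.Re R : {additive R[i] -> R})).
    by apply: eq_bigr => x _; rewrite !mxE; case: (u 0 x) => p q /=; rewrite mulr0 subr0.
  rewrite (raddf_sum (@complex.Im R : {additive R[i] -> R})).
  by apply: eq_bigr => x _; rewrite !mxE; case: (u 0 x) => p q /=; rewrite mulr0 add0r.
by rewrite csqnormE mulrDr lerD.
Qed.

Lemma cnorm_real m (v : 'rV[R]_m) : cnorm (toC v) = Num.sqrt (sqnorm v).
Proof.
congr Num.sqrt; apply: eq_bigr => x _.
by rewrite mxE normc_sqr /= expr0n addr0.
Qed.

(** The crude factor [m] is harmless: this serves for an adjugate of size [r.+1], which does not
    grow with [n]. *)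
Lemma cnorm_mul_entry_le m (u : 'rV[C]_m) (M : 'M[C]_m) (B : R) :
  0 <= B -> (forall i j, normc (M i j) <= B) ->
  cnorm (u *m M) <= m%:R * B * cnorm u.
Proof.
move=> B0 MB; rewrite -ler_sqr ?nnegrE ?mulr_ge0 ?cnorm_ge0//.
rewrite !exprMn !cnorm_sqr.
apply: (@le_trans _ _ (\sum_(y < m) (m%:R * B ^+ 2) * csqnorm u)); last first.
  by rewrite sumr_const card_ord -[leLHS]mulr_natl !mulrA -expr2.
apply: ler_sum => y _; rewrite mxE.
have s0 : 0 <= \sum_x normc (M x y) ^+ 2.
  by apply: sumr_ge0 => x _; exact: sqr_ge0.
apply: (@le_trans _ _ ((cnorm u * Num.sqrt (\sum_x normc (M x y) ^+ 2)) ^+ 2)).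
  rewrite ler_sqr ?nnegrE ?normc_ge0 ?mulr_ge0 ?sqrtr_ge0//.
  exact: cnorm_pairing.
rewrite exprMn cnorm_sqr mulrC ler_wpM2r ?csqnorm_ge0// sqr_sqrtr//.
apply: (@le_trans _ _ (\sum_(x < m) B ^+ 2)).
  by apply: ler_sum => x _; rewrite ler_sqr ?nnegrE ?normc_ge0.
by rewrite sumr_const card_ord -[leLHS]mulr_natl.
Qed.

Lemma cnorm_row_unitary m n (Q : 'M[C]_(m, n)) (w : 'rV[C]_m) :
  Q *m (map_mx Num.conj Q^T) = 1%:M -> cnorm (w *m Q) = cnorm w.
Proof.
have csE k (u : 'rV[C]_k) : (csqnorm u)%:C%C = (u *m map_mx Num.conj u^T) 0 0.
  rewrite mxE rmorph_sum; apply: eq_bigr => x _.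
  by rewrite rmorphXn /= normcE normCK !mxE.
move=> QQ; congr Num.sqrt; apply: (@complexI R); rewrite !csE.
by rewrite trmx_mul map_mxM mulmxA -(mulmxA w) QQ mulmx1.
Qed.

End ComplexNorm.

(** * Localization of the spectrum *)

Section InvariantSubspace.
Variable F : fieldType.

(** In the rank factorization of [v] the left factor is a nonzero scalar, so [v] is proportional to
    the first row of the invertible [row_ebase v]. *)
Lemma nz_row_completion n (v : 'rV[F]_n.+1) : v != 0 ->
  exists2 E : 'M[F]_n.+1, E \in unitmx & exists a, row 0 E = a *: v.
Proof.
move=> v0; exists (row_ebase v); first exact: row_ebase_unit.
have rv : \rank v = 1%N by rewrite rank_rV v0.
have := mulmx_ebase v; rewrite rv => vE.
set c := col_ebase v 0 0; exists c^-1.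
have c0 : c != 0.
  apply: contraNneq v0 => c0; rewrite -vE [col_ebase v]mx11_scalar -/c c0.
  by rewrite raddf0 !mul0mx.
rewrite -[in RHS]vE [col_ebase v]mx11_scalar -/c mul_scalar_mx -scalemxAl scalerA.
rewrite mulVf// scale1r; apply/rowP => j; rewrite !mxE (bigD1 0)//= mxE eqxx mul1r.
rewrite big1 ?addr0// => i i0; rewrite mxE /=.
by move: i0; rewrite -val_eqE /= eq_sym => /negPf ->; rewrite mul0r.
Qed.

(** Deflation: completing an eigenvector for the head of [l] to a basis makes [A] block lower
    triangular, and the tail of [l] still divides the characteristic polynomial of the remaining
    block. Divisibility keeps track of multiplicities, and [B'] records that the rows of [B] are
    independent. *)
Lemma invariant_subspace (l : seq F) : forall n (A : 'M[F]_n),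
  (\prod_(x <- l) ('X - x%:P) %| char_poly A) ->
  exists (B : 'M[F]_(size l, n)) (B' : 'M[F]_(n, size l)) (T : 'M[F]_(size l)),
    [/\ B *m B' = 1%:M, B *m A = T *m B & \det T = \prod_(x <- l) x].
Proof.
elim: l => [|a l IH] n A dvdA.
  exists 0, 0, 0; split; first by apply/matrixP => -[].
  - by apply/matrixP => -[].
  - by rewrite big_nil det_mx00.
case: n A dvdA => [|n] A.
  rewrite big_cons => /dvdp_leq; rewrite /char_poly det_mx00 oner_neq0 => /(_ isT).
  rewrite size_poly1 size_Mmonic ?polyXsubC_eq0 ?monic_prod_XsubC//.
  by rewrite size_XsubC addSn /= add1n size_prod_XsubC.
rewrite big_cons => dvdA.
have ra : root (char_poly A) a.
  by rewrite -dvdp_XsubCl (dvdp_trans _ dvdA)// dvdp_mulr.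
move: (ra); rewrite -eigenvalue_root_char => /eigenvalueP[v vA v0].
have [E Eu [c Ev]] := nz_row_completion v0.
pose M : 'M_(1 + n) := E *m A *m invmx E.
have M0 : ursubmx M = 0 /\ ulsubmx M = a%:M.
  have r0 : row 0 (E *m A *m invmx E) = a *: row 0 1%:M.
    rewrite !row_mul Ev -scalemxAl vA scalerA (mulrC c) -scalerA -Ev.
    by rewrite -scalemxAl -row_mul mulmxV.
  have Mrow j : M 0 j = a * (0 == j)%:R.
    by move/rowP: r0 => /(_ j); rewrite mxE /M => ->; rewrite !mxE.
  have l0 : lshift n 0 = 0 :> 'I_(1 + n) by exact: val_inj.
  split.
    apply/rowP => j; have := Mrow (rshift 1 j).
    move: M {r0 Mrow} => M'; rewrite !mxE l0 => ->.
    by rewrite -val_eqE /= mulr0.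
  apply/matrixP => i j; rewrite !ord1; have := Mrow 0.
  move: M {r0 Mrow} => M'; rewrite !mxE l0 => ->.
  by rewrite !eqxx mulr1 mulr1n.
have [Mur Mul] := M0.
have ME : M = block_mx a%:M 0 (dlsubmx M) (drsubmx M).
  by rewrite -[LHS]submxK Mul Mur.
have cM : char_poly A = ('X - a%:P) * char_poly (drsubmx M).
  have -> : char_poly A = char_poly M.
    rewrite /char_poly /char_poly_mx /M !map_mxM map_invmx.
    set EP := map_mx _ E; have EPu : EP \in unitmx by rewrite map_unitmx.
    have -> : 'X%:M - EP *m map_mx polyC A *m invmx EP =
        EP *m ('X%:M - map_mx polyC A) *m invmx EP.
      by rewrite mulmxBr mulmxBl scalar_mxC mulmxK.
    by rewrite !det_mulmx mulrAC -det_mulmx mulmxV// det1 mul1r.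
  rewrite /char_poly /char_poly_mx {1}ME map_block_mx (scalar_mx_block 1 n 'X).
  rewrite opp_block_mx add_block_mx map_mx0 oppr0 addr0 det_lblock.
  by congr (_ * _); rewrite det_mx11 !mxE /= mulr1n.
have dvdM : \prod_(x <- l) ('X - x%:P) %| char_poly (drsubmx M).
  by move: dvdA; rewrite cM dvdp_mul2l// polyXsubC_eq0.
have [B [B' [T [BB' BM detT]]]] := IH n _ dvdM.
pose K : 'M_(1 + size l, 1 + n) := block_mx 1%:M 0 0 B.
pose K' : 'M_(1 + n, 1 + size l) := block_mx 1%:M 0 0 B'.
pose S : 'M_(1 + size l) := block_mx a%:M 0 (B *m dlsubmx M) T.
have KK' : K *m K' = 1%:M.
  rewrite /K /K' mulmx_block BB' !mul0mx !mulmx0 !mul1mx !addr0 !add0r.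
  by rewrite -scalar_mx_block.
have KM : K *m M = S *m K.
  rewrite ME /K /S !mulmx_block !mul0mx !mulmx0 !mul1mx !mulmx1.
  by rewrite !addr0 !add0r BM.
have detS : \det S = \prod_(x <- a :: l) x.
  by rewrite det_lblock det_scalar1 detT big_cons.
exists (K *m E), (invmx E *m K'), S; split=> //.
  by rewrite mulmxA mulmxK.
have EA : E *m A = M *m E by rewrite /M mulmxKV.
transitivity (K *m M *m E); first by rewrite -(mulmxA K E A) EA (mulmxA K M E).
by rewrite KM -(mulmxA S K E).
Qed.

End InvariantSubspace.

(** Gram-Schmidt keeps the row space, so [T] is only conjugated by the change of basis and its
    determinant survives. *)
Lemma unitary_invariant_subspace (C : numClosedFieldType) (l : seq C) n (A : 'M[C]_n) :
  (\prod_(x <- l) ('X - x%:P) %| char_poly A) ->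
  exists (Q : 'M[C]_(size l, n)) (T : 'M[C]_(size l)),
    [/\ Q *m map_mx Num.conj Q^T = 1%:M, Q *m A = T *m Q &
        \det T = \prod_(x <- l) x].
Proof.
move=> /invariant_subspace[B [B' [T [BB' BA detT]]]].
have fB : row_free B by apply/row_freeP; exists B'.
have ln : (size l <= n)%N by rewrite -(eqP fB) rank_leq_col.
have /unitarymxP QQ := schmidt_unitarymx B ln.
set Q := schmidt B in QQ.
have eqQ : (Q :=: B)%MS by exact: eqmx_schmidt_free.
have /submxP[S QS] : (Q <= B)%MS by rewrite eqQ.
have /submxP[S' BS] : (B <= Q)%MS by rewrite eqQ.
have SS : S *m S' = 1%:M.
  have SSQ : S *m S' *m Q = Q by rewrite -mulmxA -BS -QS.
  by rewrite -[LHS]mulmx1 -QQ mulmxA SSQ.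
exists Q, (S *m T *m S'); split=> //.
  by rewrite {1}QS -(mulmxA S B A) BA {1}BS !mulmxA.
by rewrite !det_mulmx mulrAC -det_mulmx SS det1 mul1r.
Qed.

Section Spectrum.
Variables (R : rcfType) (n r : nat).
Local Notation C := R[i].
Local Notation normc := (@Normc.normc R).

Variables (Vp : 'M[R]_(n, r)) (Vm : 'M[R]_(r, n)) (d : 'rV[R]_r).
Variables (X : 'M[R]_n) (b c lo hi : R).
Hypotheses (VmVp : Vm *m Vp = 1%:M).
Hypothesis Vp1 : forall j, \sum_x Vp x j ^+ 2 = 1.
Hypothesis c0 : 0 <= c.
Hypothesis Vmc : forall j, \sum_x Vm j x ^+ 2 <= c ^+ 2.
Hypothesis lo0 : 0 < lo.
Hypothesis dlohi : forall j, lo <= d 0 j <= hi.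
Hypothesis b0 : 0 <= b.
Hypothesis Xb : forall v, sqnorm (v *m X) <= b ^+ 2 * sqnorm v.

Definition lowrank : 'M[R]_n := Vp *m diag_mx d *m Vm.

Let d_ge0 j : 0 <= d 0 j.
Proof. by have /andP[/(le_trans (ltW lo0))] := dlohi j. Qed.

Lemma normc_mul_Vp (u : 'rV[C]_n) j : normc ((u *m toC Vp) 0 j) <= cnorm u.
Proof.
rewrite mxE; apply: le_trans (cnorm_pairing _ _) _.
rewrite [X in _ * X](_ : _ = 1) ?mulr1// -[RHS]sqrtr1 -(Vp1 j); congr Num.sqrt.
by apply: eq_bigr => x _; rewrite mxE normc_sqr /= expr0n addr0.
Qed.

Lemma cnorm_mul_diag_Vm (w : 'rV[C]_r) :
  cnorm (w *m toC (diag_mx d *m Vm)) <= \sum_j normc (w 0 j) * (d 0 j * c).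
Proof.
rewrite mulmx_sum_row; apply: le_trans (cnorm_sum _ _ _) _.
apply: ler_sum => j _; rewrite cnormZ ler_wpM2l ?normc_ge0//.
have -> : row j (toC (diag_mx d *m Vm)) = (d 0 j)%:C%C *: toC (row j Vm).
  apply/rowP => x; rewrite !mxE -rmorphM; congr (_%:C)%C.
  rewrite (bigD1 j)//= mxE eqxx mulr1n big1 ?addr0// => i ij.
  by rewrite mxE eq_sym (negPf ij) mulr0n mul0r.
rewrite cnormZ normc_real ger0_norm// ler_wpM2l// cnorm_real.
rewrite -(ger0_norm c0) -sqrtr_sqr ler_sqrt ?sqr_ge0//.
by rewrite /sqnorm; under eq_bigr do rewrite mxE.
Qed.

Lemma toC_lowrank : toC lowrank = toC Vp *m toC (diag_mx d *m Vm).
Proof. by rewrite -map_mxM mulmxA. Qed.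

Lemma cnorm_mul_perturbed (u : 'rV[C]_n) :
  cnorm (u *m toC (lowrank + X)) <= (r%:R * (hi * c) + b) * cnorm u.
Proof.
rewrite map_mxD mulmxDr; apply: le_trans (cnormD _ _) _.
rewrite mulrDl lerD//; last exact: cnorm_mul_real.
rewrite toC_lowrank mulmxA; apply: le_trans (cnorm_mul_diag_Vm _) _.
apply: (@le_trans _ _ (\sum_(j < r) (hi * c) * cnorm u)); last first.
  by rewrite sumr_const card_ord -[leLHS]mulr_natl mulrA.
apply: ler_sum => j _; rewrite mulrC ler_pM ?normc_ge0 ?mulr_ge0//.
  by rewrite ler_wpM2r//; have /andP[] := dlohi j.
exact: normc_mul_Vp.
Qed.

(* Pairing the eigenvector with [Vp] gives [(z - d_j) (u Vp)_j = (u X Vp)_j]. *)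
Lemma eigenvalue_localized (rho : R) (z : C) :
  0 < rho -> b * c * r%:R * hi / rho + b < lo / 2 ->
  eigenvalue (toC (lowrank + X)) z ->
  normc z <= b * (1 + 2 * r%:R * c) \/ exists j, normc (z - (d 0 j)%:C%C) < rho.
Proof.
move=> rho0 small /eigenvalueP[u uA u0].
have [/existsP[j zj]|/existsPn far] := boolP [exists j, normc (z - (d 0 j)%:C%C) < rho].
  by right; exists j.
left; have {}far j : rho <= normc (z - (d 0 j)%:C%C) by rewrite leNgt far.
have cu0 := cnorm_gt0 u0.
have uE : z *: u = u *m toC Vp *m toC (diag_mx d *m Vm) + u *m toC X.
  by rewrite -uA map_mxD mulmxDr toC_lowrank mulmxA.
pose w := u *m toC Vp.
have wE j : (z - (d 0 j)%:C%C) * w 0 j = (u *m toC X *m toC Vp) 0 j.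
  have : z *: w = w *m toC (diag_mx d) + u *m toC X *m toC Vp.
    rewrite scalemxAl uE mulmxDl; congr (_ + _).
    by rewrite -/w -(mulmxA w) -map_mxM -(mulmxA (diag_mx d)) VmVp mulmx1.
  move=> /rowP/(_ j); rewrite mxE [in RHS]mxE => zw.
  have dE i : toC (diag_mx d) i j = (d 0 i *+ (i == j))%:C%C by rewrite !mxE.
  rewrite mulrBl zw addrAC [X in X - _]mxE (bigD1 j)//= big1 => [|i ij].
    by rewrite dE eqxx addr0 [w 0 j * _]mulrC subrr add0r.
  by rewrite dE (negPf ij) rmorph0 mulr0.
have uX : cnorm (u *m toC X) <= b * cnorm u by exact: cnorm_mul_real.
have wle j : normc (w 0 j) <= b * cnorm u / normc (z - (d 0 j)%:C%C).
  rewrite ler_pdivlMr ?(lt_le_trans rho0)// mulrC -Normc.normcM wE.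
  exact: le_trans (normc_mul_Vp _ _) uX.
have zle : normc z <= b + b * c * \sum_j d 0 j / normc (z - (d 0 j)%:C%C).
  rewrite -(ler_pM2r cu0) -cnormZ uE; apply: le_trans (cnormD _ _) _.
  rewrite mulrDl addrC lerD//.
  apply: le_trans (cnorm_mul_diag_Vm _) _; rewrite mulr_sumr mulr_suml.
  apply: ler_sum => j _.
  apply: (@le_trans _ _ (b * cnorm u / normc (z - (d 0 j)%:C%C) * (d 0 j * c))).
    by rewrite ler_wpM2r// mulr_ge0.
  by rewrite le_eqVlt; apply/orP; left; apply/eqP; ring.
have bc0 : 0 <= b * c by rewrite mulr_ge0.
(* If [z] is large, the gap [rho] to every [d_j] bounds the sum and contradicts [small]. If [z] is
   below [lo / 2], then it is at distance at least [d_j / 2] from each [d_j], so every ratio is at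
   most 2. *)
have [zlo|zlo] := leP (lo / 2) (normc z).
  suff : normc z <= b * c * r%:R * hi / rho + b.
    by move=> h; have := le_lt_trans (le_trans zlo h) small; rewrite ltxx.
  apply: le_trans zle _; rewrite addrC lerD2r.
  rewrite (_ : b * c * r%:R * hi / rho = b * c * (r%:R * (hi / rho))); last by ring.
  rewrite ler_wpM2l// mulr_natl.
  rewrite -[X in _ *+ X]card_ord -sumr_const; apply: ler_sum => j _.
  have /andP[dlo dhi] := dlohi j.
  by rewrite ler_pM ?invr_ge0 ?normc_ge0// lef_pV2 ?posrE// (lt_le_trans rho0).
apply: le_trans zle _; rewrite mulrDr mulr1 lerD2l.
rewrite (_ : b * (2 * r%:R * c) = b * c * (r%:R * 2)); last by ring.
rewrite ler_wpM2l// mulr_natl -[X in _ *+ X]card_ord -sumr_const.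
apply: ler_sum => j _; have /andP[dlo dhi] := dlohi j.
rewrite ler_pdivrMr ?(lt_le_trans rho0)//.
have : normc (d 0 j)%:C%C <= normc (z - (d 0 j)%:C%C) + normc z.
  rewrite normcB -{1}(subrK z (d 0 j)%:C%C); exact: le_normcD.
rewrite normc_real ger0_norm//; lra.
Qed.

(* A unit vector of the invariant subspace which is killed by [Vp] would be
   contracted by [T], whose determinant is too large for that. *)
Lemma large_eigenvalues_le (l : seq C) :
  (\prod_(x <- l) ('X - x%:P) %| char_poly (toC (lowrank + X))) ->
  (forall x, x \in l -> lo / 2 <= normc x) ->
  b * (r.+1%:R * (r`!%:R * (r%:R * (hi * c) + b) ^+ r)) < (lo / 2) ^+ r.+1 ->
  (size l <= r)%N.
Proof.
move=> dvdl large small; rewrite leqNgt; apply/negP => rl.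
pose l' := take r.+1 l.
have sl' : size l' = r.+1 by rewrite size_takel.
have dvdl' : \prod_(x <- l') ('X - x%:P) %| char_poly (toC (lowrank + X)).
  by apply: dvdp_trans dvdl; rewrite -(cat_take_drop r.+1 l) big_cat dvdp_mulr.
have [Q [T [QQ QA detT]]] := unitary_invariant_subspace dvdl'.
move: Q T QQ QA detT; rewrite sl' => Q T QQ QA detT.
have [w w0 wQ] : exists2 w : 'rV_r.+1, w != 0 & w *m (Q *m toC Vp) = 0.
  have : kermx (Q *m toC Vp) != 0.
    rewrite -mxrank_eq0 mxrank_ker subn_eq0 -ltnNge ltnS.
    exact: rank_leq_col.
  case/rowV0Pn => w /sub_kermxP wQ w0; by exists w.
have wT : cnorm (w *m T) <= b * cnorm w.
  rewrite -(cnorm_row_unitary (w *m T) QQ) -mulmxA -QA map_mxD mulmxDr mulmxDr.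
  rewrite toC_lowrank !mulmxA -(mulmxA w) wQ mul0mx add0r.
  by rewrite -(cnorm_row_unitary w QQ); exact: cnorm_mul_real.
(* [T] is the compression of [G + X] to the orthonormal rows of [Q], so the norm bound [H] of
   [G + X] also bounds its entries. *)
pose H := r%:R * (hi * c) + b.
have Q1 i : cnorm (row i Q) = 1.
  rewrite rowE cnorm_row_unitary// -[RHS]sqrtr1; congr Num.sqrt.
  rewrite /csqnorm (bigD1 i)//= mxE !eqxx Normc.normc1 expr1n big1 ?addr0// => j ji.
  by rewrite mxE eqxx (negPf ji) Normc.normc0 expr0n.
have TH i j : normc (T i j) <= H.
  have -> : T i j = \sum_x (row i Q *m toC (lowrank + X)) 0 x * (map_mx Num.conj Q^T) x j.
    transitivity ((T *m Q *m map_mx Num.conj Q^T) i j); first by rewrite -mulmxA QQ mulmx1.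
    by rewrite -QA mxE; apply: eq_bigr => x _; rewrite -row_mul [in RHS]mxE.
  apply: le_trans (cnorm_pairing _ _) _.
  have -> : \sum_x normc ((map_mx Num.conj Q^T) x j) ^+ 2 = csqnorm (row j Q).
    apply: eq_bigr => x _; rewrite !mxE; congr (_ ^+ _); apply: (@complexI R).
    by rewrite !normcE norm_conjC.
  rewrite -/(cnorm (row j Q)) Q1 mulr1.
  by apply: le_trans (cnorm_mul_perturbed _) _; rewrite Q1 mulr1.
(* Leibniz expansion of an [r] by [r] minor. *)
have adjH i j : normc ((\adj T) i j) <= r`!%:R * H ^+ r.
  rewrite mxE /cofactor Normc.normcM /determinant.
  have n1 k : normc ((-1) ^+ k) = 1.
    by elim: k => [|k IH]; rewrite ?Normc.normc1// exprS Normc.normcM IH mulr1 normcN Normc.normc1.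
  rewrite n1 mul1r; apply: le_trans (normc_sum _ _ _) _.
  apply: (@le_trans _ _ (\sum_(s : {perm 'I_r}) H ^+ r)).
    apply: ler_sum => s _; rewrite Normc.normcM n1 mul1r normc_prod.
    apply: (@le_trans _ _ (\prod_(k < r) H)); last by rewrite prodr_const card_ord.
    by apply: ler_prod => k _; rewrite normc_ge0 !mxE TH.
  by rewrite sumr_const card_Sn -[leLHS]mulr_natl.
have H0 : 0 <= H by exact: le_trans (normc_ge0 _) (TH 0 0).
(* Since [T *m \adj T] is the scalar [\det T], smallness of [w *m T] forces a small determinant,
   whereas the latter is a product of [r.+1] numbers of modulus at least [lo / 2]. *)
have : normc (\det T) * cnorm w <= b * (r.+1%:R * (r`!%:R * H ^+ r)) * cnorm w.
  rewrite -cnormZ -mul_mx_scalar -mul_mx_adj mulmxA.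
  apply: le_trans (cnorm_mul_entry_le _ _ adjH) _.
    by rewrite mulr_ge0 ?exprn_ge0.
  apply: (@le_trans _ _ (r.+1%:R * (r`!%:R * H ^+ r) * (b * cnorm w))).
    by rewrite ler_wpM2l ?mulr_ge0 ?exprn_ge0.
  by rewrite le_eqVlt; apply/orP; left; apply/eqP; ring.
rewrite ler_pM2r ?cnorm_gt0// leNgt => /negP; apply.
apply: lt_le_trans small _; rewrite detT normc_prod -sl'.
have : all (fun x => lo / 2 <= normc x) l'.
  by apply/allP => x /mem_take; exact: large.
elim: (l') => [_|x s IH /= /andP[xl /IH sl]]; first by rewrite big_nil.
by rewrite big_cons exprS ler_pM ?exprn_ge0// ltW// divr_gt0.
Qed.

End Spectrum.

(** * Real outliers by sign changes, and their rank in the ordered spectrum *)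

Lemma poly_sign_change (R : rcfType) (p : {poly R}) (a b : R) :
  a <= b -> p.[a] * p.[b] < 0 -> exists2 x, a < x < b & root p x.
Proof.
move=> ab pab.
have nz x : p.[x] = 0 -> (x != a) && (x != b).
  by move=> px; apply/andP; split; apply: contraTneq pab => <-;
     rewrite px ?mul0r ?mulr0 ltxx.
suff [x /andP[ax xb] rx] : exists2 x, a <= x <= b & root p x.
  exists x => //; have /andP[xa xb'] := nz _ (rootP rx).
  by rewrite !lt_neqAle ax xb xb' eq_sym xa.
have [pa|pa] := leP p.[a] 0.
  apply: poly_ivt => //; rewrite pa /=.
  by case: (ltP p.[b] 0) => // pb; move: pab; rewrite ltNge mulr_le0// ltW.
have [|x axb rx] := @poly_ivt _ (- p) a b ab; last by exists x; rewrite // -rootN.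
rewrite !hornerN !oppr_le0 oppr_ge0 (ltW pa) /=.
by move: pab; rewrite pmulr_rlt0// => /ltW.
Qed.

Lemma horner_char_poly (R : comNzRingType) n (A : 'M[R]_n) (x : R) :
  (char_poly A).[x] = \det (x%:M - A).
Proof.
rewrite /char_poly -horner_evalE -det_map_mx; congr (\det _).
apply/matrixP => i j; rewrite !mxE /= /horner_eval hornerD hornerN hornerC.
by rewrite hornerMn hornerX.
Qed.

(* Both sides compute the determinant of [[x, U], [V, 1]]. *)
Lemma det_sylvester (R : comNzRingType) m n (U : 'M[R]_(n, m)) (V : 'M[R]_(m, n)) (x : R) :
  x ^+ m * \det (x%:M - U *m V) = x ^+ n * \det (x%:M - V *m U).
Proof.
pose M := block_mx x%:M U V 1%:M.
have M1 : M *m block_mx 1%:M 0 (- V) 1%:M = block_mx (x%:M - U *m V) U 0 1%:M.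
  rewrite mulmx_block !mulmx1 !mulmx0 add0r mul1mx subrr add0r.
  by rewrite mulmxN.
have M2 : block_mx 1%:M 0 (- V) x%:M *m M = block_mx x%:M U 0 (x%:M - V *m U).
  rewrite mulmx_block !mul1mx !mul0mx !addr0 !mulNmx mulmx1.
  by rewrite scalar_mxC addNr [- _ + _]addrC.
have := congr1 determinant M1; rewrite det_mulmx det_lblock det_ublock !det1 !mulr1 => <-.
by have := congr1 determinant M2; rewrite det_mulmx det_lblock det_ublock det1 mul1r !det_scalar.
Qed.

(** A strictly increasing map is at least the identity; conjugating it by [rev_ord] gives the other
    inequality. *)
Lemma strict_mono_ord (r : nat) (f : 'I_r -> 'I_r) :
  (forall i j : 'I_r, (i < j)%N -> (f i < f j)%N) -> forall i, f i = i.
Proof.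
have lb (g : 'I_r -> 'I_r) : (forall i j : 'I_r, (i < j)%N -> (g i < g j)%N) ->
    forall k (kr : (k < r)%N), (k <= g (Ordinal kr))%N.
  move=> gm; elim=> // k IH kr; have := IH (ltnW kr) => h.
  exact: leq_ltn_trans h (gm _ _ _).
move=> fm i; apply/val_inj/eqP; rewrite /= eqn_leq; apply/andP; split; last first.
  by have := lb f fm i (ltn_ord i); congr (_ <= f _)%N; exact: val_inj.
have gm (j k : 'I_r) : (j < k)%N -> (rev_ord (f (rev_ord j)) < rev_ord (f (rev_ord k)))%N.
  move=> jk; have /fm /= : (rev_ord k < rev_ord j)%N by rewrite /=; have := ltn_ord k; lia.
  by have := ltn_ord (f (rev_ord j)); lia.
have := lb _ gm (rev_ord i) (ltn_ord _).
rewrite (_ : Ordinal _ = rev_ord i); last exact: val_inj.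
rewrite rev_ordK /=; have := ltn_ord i; have := ltn_ord (f i); lia.
Qed.

Section Outliers.
Variables (R : rcfType) (n r : nat).
Local Notation C := R[i].
Local Notation normc := (@Normc.normc R).

Variables (Vp : 'M[R]_(n, r)) (Vm : 'M[R]_(r, n)) (d : 'rV[R]_r).
Variables (X : 'M[R]_n) (b c lo hi rho : R).
Hypotheses (VmVp : Vm *m Vp = 1%:M).
Hypothesis Vp1 : forall j, \sum_x Vp x j ^+ 2 = 1.
Hypothesis c0 : 0 <= c.
Hypothesis Vmc : forall j, \sum_x Vm j x ^+ 2 <= c ^+ 2.
Hypothesis lo0 : 0 < lo.
Hypothesis dlohi : forall j, lo <= d 0 j <= hi.
Hypothesis b0 : 0 <= b.
Hypothesis Xb : forall v, sqnorm (v *m X) <= b ^+ 2 * sqnorm v.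
Hypothesis rho0 : 0 < rho.
Hypothesis rho_lo : rho <= lo / 2.
Hypothesis dsep : forall i j : 'I_r, (i < j)%N -> d 0 j + 2 * rho <= d 0 i.
Hypothesis small_loc : b * c * r%:R * hi / rho + b < lo / 2.
Hypothesis small_bulk : b * (1 + 2 * r%:R * c) < lo / 2.
Hypothesis small_count :
  b * (r.+1%:R * (r`!%:R * (r%:R * (hi * c) + b) ^+ r)) < (lo / 2) ^+ r.+1.

Local Notation G := (lowrank Vp Vm d).

Let dsepD j k : j != k -> 2 * rho <= `|d 0 j - d 0 k|.
Proof.
rewrite -val_eqE neq_ltn => /orP[] /dsep h.
  rewrite ger0_norm; move: h rho0; lra.
rewrite distrC ger0_norm; move: h rho0; lra.
Qed.

(** By [det_sylvester] the polynomial is, up to positive powers of [x], the product of the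
    [x - d_k]. The factor [j] takes opposite signs at the two ends; for [k] other than [j] the two
    values multiply to [(d_j - d_k)^2 - rho^2], positive by separation. *)
Lemma char_poly_lowrank_sign j :
  (char_poly G).[d 0 j - rho] * (char_poly G).[d 0 j + rho] < 0.
Proof.
have /andP[dj _] := dlohi j.
have cE x : x ^+ r * (char_poly G).[x] = x ^+ n * \prod_k (x - d 0 k).
  rewrite horner_char_poly /lowrank -mulmxA det_sylvester -mulmxA VmVp mulmx1; congr (_ * _).
  rewrite (_ : x%:M - _ = diag_mx (\row_k (x - d 0 k))) ?det_diag.
    by apply: eq_bigr => k _; rewrite mxE.
  by apply/matrixP => k l; rewrite !mxE mulrnBl.
have x1 : 0 < d 0 j - rho by move: rho_lo lo0 dj; lra.
have x2 : 0 < d 0 j + rho by move: rho0 x1; lra.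
rewrite -(@pmulr_rlt0 _ ((d 0 j - rho) ^+ r * (d 0 j + rho) ^+ r)); last first.
  by rewrite mulr_gt0// exprn_gt0.
rewrite mulrACA !cE mulrACA.
rewrite pmulr_rlt0 ?mulr_gt0 ?exprn_gt0// -big_split /= (bigD1 j)//=.
rewrite pmulr_llt0; first by move: rho0; nra.
apply: prodr_gt0 => k kj; have := dsepD kj; rewrite -subr_ge0 => h.
have : rho ^+ 2 < `|d 0 k - d 0 j| ^+ 2.
  by rewrite ltr_sqr ?nnegrE ?normr_ge0 ?(ltW rho0)//; move: h rho0; lra.
rewrite real_normK ?num_real//; nra.
Qed.

Lemma char_poly_same_sign (x : R) :
  (forall t, 0 <= t <= 1 -> ~~ root (char_poly (G + t *: X)) x) ->
  0 < (char_poly G).[x] * (char_poly (G + X)).[x].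
Proof.
move=> nr; rewrite ltNge; apply/negP => le0.
(* Here [x] is fixed and the indeterminate is the deformation parameter. *)
pose q : {poly R} := \det (map_mx polyC (x%:M - G) - 'X *: map_mx polyC X).
have qE t : q.[t] = (char_poly (G + t *: X)).[x].
  rewrite horner_char_poly /q -horner_evalE -det_map_mx; congr (\det _).
  apply/matrixP => i j; rewrite !mxE /= /horner_eval.
  rewrite hornerD hornerN hornerC hornerM hornerX hornerC.
  by rewrite opprD addrA.
have q01 : q.[0] * q.[1] < 0.
  rewrite !qE scale0r scale1r addr0 lt_neqAle le0 andbT mulf_neq0//.
    by have := nr 0; rewrite lexx ler01 scale0r addr0 => /(_ isT).
  by have := nr 1; rewrite lexx ler01 scale1r => /(_ isT).
have [t /andP[t0 t1] /rootP] := poly_sign_change ler01 q01.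
by rewrite qE => /rootP; apply/negP/nr; rewrite !ltW.
Qed.

Lemma outlier_exists j :
  exists2 z : R, `|z - d 0 j| < rho & root (char_poly (G + X)) z.
Proof.
have /andP[dj _] := dlohi j.
(* At distance exactly [rho] from [d_j] there is no eigenvalue: the point is too large for the bulk,
   the strict inequality of the localization excludes [d_j], and separation excludes the other
   [d_k]. *)
have nr x : `|x - d 0 j| = rho ->
    forall t, 0 <= t <= 1 -> ~~ root (char_poly (G + t *: X)) x.
  move=> xd t /andP[t0 t1]; apply/negP.
  rewrite -eigenvalue_root_char -(eigenvalue_map (real_complex R)) => ev.
  have tXb v : sqnorm (v *m (t *: X)) <= b ^+ 2 * sqnorm v.
    apply: le_trans (Xb v); rewrite -scalemxAr /sqnorm.
    apply: ler_sum => y _; rewrite mxE exprMn ler_piMl ?sqr_ge0//.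
    by rewrite expr_le1.
  have [|[k]] := eigenvalue_localized VmVp Vp1 c0 Vmc lo0 dlohi b0 tXb rho0 small_loc ev.
    rewrite normc_real => h; have : d 0 j <= `|x| + rho.
      by rewrite -xd distrC -[leLHS]ger0_norm; [rewrite -{1}(subrK x (d 0 j)) addrC ler_normD| move: lo0 dj; lra].
    by move: h small_bulk rho_lo dj; lra.
  rewrite -rmorphB normc_real; have [->|jk] := eqVneq k j; first by rewrite xd ltxx.
  move=> h; have := dsepD jk; have : `|d 0 k - d 0 j| <= `|x - d 0 k| + `|x - d 0 j|.
    by rewrite (distrC x (d 0 k)) -[X in `|X| <= _](subrKA x) ler_normD.
  by move: h; rewrite xd; lra.
have h1 := char_poly_same_sign (nr (d 0 j - rho) _).
have h2 := char_poly_same_sign (nr (d 0 j + rho) _).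
have h3 := char_poly_lowrank_sign j.
have [||z /andP[z1 z2] rz] := @poly_sign_change R (char_poly (G + X)) (d 0 j - rho) (d 0 j + rho).
- by move: rho0; lra.
- have {}h1 := h1 _; have {}h2 := h2 _.
  have e1 : `|d 0 j - rho - d 0 j| = rho by rewrite addrAC subrr add0r normrN ger0_norm// ltW.
  have e2 : `|d 0 j + rho - d 0 j| = rho by rewrite addrAC subrr add0r ger0_norm// ltW.
  have {}h1 := h1 e1; have {}h2 := h2 e2.
  move: h1 h2 h3; set g1 := (char_poly G).[_]; set g2 := (char_poly G).[_].
  set a1 := _.[_]; set a2 := _.[_] => h1 h2 h3.
  have : (g1 * a1) * (g2 * a2) > 0 by rewrite mulr_gt0.
  by rewrite mulrACA nmulr_rgt0.
by exists z => //; rewrite ltr_norml; apply/andP; split; move: z1 z2; lra.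
Qed.

(** The [r] real roots sit at distinct positions [s j] of the list. At most [r] entries are large,
    so these are all of them; by the ordering they fill the first [r] places, in the order of the
    [d_j], hence [s j = j]. *)
Lemma outliers_and_bulk (l : 'I_n -> C) :
  char_poly (toC (G + X)) = \prod_(i < n) ('X - (l i)%:P) ->
  (forall i j : 'I_n, (i <= j)%N -> normc (l j) <= normc (l i)) ->
  (forall (i : 'I_n) (j : 'I_r), i = j :> nat -> normc (l i - (d 0 j)%:C%C) < rho) /\
  (forall i : 'I_n, (r <= i)%N -> normc (l i) <= b * (1 + 2 * r%:R * c)).
Proof.
move=> cl lsort.
have [z zd zr] : exists2 z : 'I_r -> R, forall j, `|z j - d 0 j| < rho &
    forall j, root (char_poly (G + X)) (z j).
  apply: (@fin_all_exists2 _ _ (fun j z => `|z - d 0 j| < rho)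
    (fun j z => root (char_poly (G + X)) z)) => j.
  exact: outlier_exists.
have zlo j : lo / 2 <= z j.
  have := zd j; have /andP[dj _] := dlohi j; rewrite ltr_norml => /andP[z1 z2].
  by move: rho_lo dj z1; lra.
have z0 j : 0 <= z j by apply: le_trans (zlo j); rewrite divr_ge0// ltW.
have zdec (i j : 'I_r) : (i < j)%N -> z j < z i.
  move=> ij; have := zd i; have := zd j; have := dsep ij.
  by rewrite !ltr_norml => h /andP[h1 h2] /andP[h3 h4]; lra.
have [s sE] : exists s : 'I_r -> 'I_n, forall j, l (s j) = (z j)%:C%C.
  apply: (@fin_all_exists _ _ (fun j i => l i = (z j)%:C%C)) => j.
  have : root (char_poly (toC (G + X))) (z j)%:C%C.
    by rewrite -map_char_poly fmorph_root.
  have -> : char_poly (toC (G + X)) = \prod_(a <- codom l) ('X - a%:P).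
    by rewrite cl /codom /image_mem big_map big_enum.
  by rewrite root_prod_XsubC => /codomP[i ->]; exists i.
have sinj : injective s.
  move=> i j sij; have : z i = z j by apply: (@complexI R); rewrite -!sE sij.
  have [//|] := eqVneq i j; rewrite -val_eqE neq_ltn => /orP[] /zdec h e.
    by move: h; rewrite e ltxx.
  by move: h; rewrite e ltxx.
have nl j : normc (l (s j)) = z j by rewrite sE normc_real ger0_norm.
pose L := [set i | lo / 2 <= normc (l i)].
have cardL : (#|L| <= r)%N.
  rewrite cardE -(size_map l); apply: (@large_eigenvalues_le _ _ _ Vp Vm d X b c lo hi) => //.
    rewrite cl big_map big_enum /= [X in _ %| X](bigID (mem L)) /=.
    exact: dvdp_mulr.
  move=> x xL; have /hasP H : has (fun i => x == l i) (enum L).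
    by move: xL; elim: (enum L) => //= i t IH; rewrite inE => /orP[->//|/IH->]; rewrite orbT.
  have [i iL /eqP->] := H.
  by move: iL; rewrite mem_enum inE.
have sL j : s j \in L by rewrite inE nl.
have Ls : L = s @: setT.
  apply/esym/eqP; rewrite eqEcard card_imset// cardsT card_ord cardL andbT.
  by apply/subsetP => _ /imsetP[j _ ->].
(* All indices up to [s j] carry entries at least as large, so [L] contains [s j + 1] indices. *)
have sr j : (s j < r)%N.
  apply: leq_trans cardL; rewrite -[X in (X <= _)%N]card_ord.
  have sn : ((s j).+1 <= n)%N by [].
  have winj : injective (widen_ord sn) by move=> k k' /(congr1 val) /= /val_inj.
  rewrite -cardsT -(card_imset _ winj); apply/subset_leq_card.
  apply/subsetP => _ /imsetP[k _ ->]; rewrite inE.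
  apply: le_trans (zlo j) _; rewrite -nl; apply: lsort => /=.
  by rewrite -ltnS.
have smono (i j : 'I_r) : (i < j)%N -> (s i < s j)%N.
  move=> ij; rewrite ltnNge; apply/negP => /lsort; rewrite !nl leNgt.
  by rewrite zdec.
have sid j : s j = j :> nat.
  by have := @strict_mono_ord r (fun j => Ordinal (sr j)) smono j => /(congr1 val).
split=> [i j ij|i ri].
  have -> : i = s j by apply: val_inj; rewrite /= sid.
  by rewrite sE -rmorphB normc_real.
have iL : normc (l i) < lo / 2.
  rewrite ltNge; apply/negP => h; have : i \in L by rewrite inE.
  rewrite Ls => /imsetP[j _ ij]; move: ri; rewrite ij sid leqNgt.
  by rewrite ltn_ord.
have ev : eigenvalue (toC (G + X)) (l i).
  rewrite eigenvalue_root_char cl /root horner_prod (bigD1 i)//=.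
  by rewrite hornerXsubC subrr mul0r.
(* A value within [rho] of some [d_k] would have modulus above [lo - rho], hence above [lo / 2]. *)
have [//|[k]] := eigenvalue_localized VmVp Vp1 c0 Vmc lo0 dlohi b0 Xb rho0 small_loc ev.
have /andP[dk _] := dlohi k.
have : normc (d 0 k)%:C%C <= normc (l i - (d 0 k)%:C%C) + normc (l i).
  rewrite normcB -{1}(subrK (l i) (d 0 k)%:C%C); exact: le_normcD.
rewrite normc_real ger0_norm; last by move: lo0 dk; lra.
by move: iL rho_lo dk; lra.
Qed.

End Outliers.

(** * The deterministic bounds in units of [t], the square root of [s] *)

Section Rescaled.
Variables (R : rcfType) (n r : nat).
Local Notation C := R[i].
Local Notation normc := (@Normc.normc R).

Variables (theta : 'I_r -> R) (tmin tmax gap c K0 K1 t : R).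
Variables (Vp : 'M[R]_(n, r)) (Vm : 'M[R]_(r, n)) (X : 'M[R]_n).
Hypotheses (VmVp : Vm *m Vp = 1%:M).
Hypothesis Vp1 : forall j, \sum_x Vp x j ^+ 2 = 1.
Hypothesis c0 : 0 <= c.
Hypothesis Vmc : forall j, \sum_x Vm j x ^+ 2 <= c ^+ 2.
Hypothesis tmin0 : 0 < tmin.
Hypothesis theta_bd : forall j, tmin <= theta j <= tmax.
Hypothesis theta_gap : forall i j : 'I_r, (i < j)%N -> theta j + gap <= theta i.
Hypothesis K00 : 0 < K0.
Hypothesis K1E : 4 * (K0 * c * r%:R * tmax) < K1 * tmin.
Hypothesis Xb : forall v, sqnorm (v *m X) <= (K0 * t) ^+ 2 * sqnorm v.
Hypothesis t0 : 0 < t.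
Hypothesis t1 : K0 < t * (tmin / 4).
Hypothesis t2 : K1 <= t * (tmin / 2).
Hypothesis t3 : 2 * K1 <= t * gap.
Hypothesis t4 : K0 * (1 + 2 * r%:R * c) < t * (tmin / 2).
Hypothesis t5 : K0 <= t.
Hypothesis t6 : K0 * (r.+1%:R * (r`!%:R * (r%:R * (tmax * c) + 1) ^+ r)) <
  t * (tmin / 2) ^+ r.+1.

Local Notation G := (lowrank Vp Vm (\row_j (t ^+ 2 * theta j))).

Hypothesis r0 : (0 < r)%N.

Let tmax0 : 0 < tmax.
Proof. by have /andP[h1 h2] := theta_bd (Ordinal r0); apply: lt_le_trans tmin0 (le_trans h1 h2). Qed.

Let K10 : 0 < K1.
Proof.
have h : 0 <= 4 * (K0 * c * r%:R * tmax) by rewrite !mulr_ge0// ltW.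
by have := le_lt_trans h K1E; rewrite pmulr_lgt0.
Qed.

(** With centers of order [t ^+ 2] and with noise and radius of order [t], the smallness conditions
    become lower bounds on [t]. The perturbation [Y] is left free so as to cover both [X] and 0. *)
Lemma rescaled_outliers_and_bulk (Y : 'M[R]_n) (l : 'I_n -> C) :
  (forall v, sqnorm (v *m Y) <= (K0 * t) ^+ 2 * sqnorm v) ->
  char_poly (toC (G + Y)) = \prod_(i < n) ('X - (l i)%:P) ->
  (forall i j : 'I_n, (i <= j)%N -> normc (l j) <= normc (l i)) ->
  (forall (i : 'I_n) (j : 'I_r), i = j :> nat ->
     normc (l i - (t ^+ 2 * theta j)%:C%C) < K1 * t) /\
  (forall i : 'I_n, (r <= i)%N -> normc (l i) <= K0 * (1 + 2 * r%:R * c) * t).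
Proof.
move=> Yb cl lsort.
have tt0 : 0 < t ^+ 2 by rewrite exprn_gt0.
have := @outliers_and_bulk R n r Vp Vm (\row_j (t ^+ 2 * theta j)) Y (K0 * t) c
  (t ^+ 2 * tmin) (t ^+ 2 * tmax) (K1 * t) VmVp Vp1 c0 Vmc.
have h1 : 0 < t ^+ 2 * tmin by rewrite mulr_gt0.
have h2 j : t ^+ 2 * tmin <= (\row_j (t ^+ 2 * theta j)) 0 j <= t ^+ 2 * tmax.
  by rewrite mxE !ler_pM2l.
have h3 : 0 <= K0 * t by rewrite mulr_ge0 ?ltW.
have h4 : 0 < K1 * t by rewrite mulr_gt0.
have h5 : K1 * t <= t ^+ 2 * tmin / 2.
  by rewrite [leRHS](_ : _ = t * (tmin / 2) * t) ?ler_pM2r//; ring.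
have h6 (i j : 'I_r) : (i < j)%N ->
    (\row_j (t ^+ 2 * theta j)) 0 j + 2 * (K1 * t) <= (\row_j (t ^+ 2 * theta j)) 0 i.
  move=> ij; rewrite !mxE; apply: (@le_trans _ _ (t ^+ 2 * (theta j + gap))).
    rewrite mulrDr lerD2l [leRHS](_ : _ = t * gap * t); last by ring.
    by rewrite mulrA ler_pM2r.
  by rewrite ler_pM2l// theta_gap.
(* One factor [t] cancels against the radius, so the ratio is [t ^+ 2] times a constant; [K1E] makes
   it less than half of the right side, and [t1] leaves the other half for the noise. *)
have h7 : K0 * t * c * r%:R * (t ^+ 2 * tmax) / (K1 * t) + K0 * t < t ^+ 2 * tmin / 2.
  have -> : K0 * t * c * r%:R * (t ^+ 2 * tmax) / (K1 * t) =
      t ^+ 2 * ((K0 * c * r%:R * tmax) / K1).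
    by field; rewrite !gt_eqF.
  have g1 : K0 * c * r%:R * tmax / K1 < tmin / 4.
    rewrite ltr_pdivrMr//; move: K1E; lra.
  have g2 : K0 * t < t ^+ 2 * (tmin / 4).
    by rewrite [ltRHS](_ : _ = t * (tmin / 4) * t) ?ltr_pM2r//; ring.
  have g3 : t ^+ 2 * (K0 * c * r%:R * tmax / K1) < t ^+ 2 * (tmin / 4).
    by rewrite ltr_pM2l.
  by move: (ltrD g3 g2); lra.
have h8 : K0 * t * (1 + 2 * r%:R * c) < t ^+ 2 * tmin / 2.
  rewrite mulrAC [ltRHS](_ : _ = t * (tmin / 2) * t) ?ltr_pM2r//; ring.
(* The left side has order [t ^ (2 r + 1)] and the right side [t ^ (2 r + 2)]; the spare factor [t]
   is what [t6] uses. *)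
have h9 : K0 * t * (r.+1%:R * (r`!%:R * (r%:R * (t ^+ 2 * tmax * c) + K0 * t) ^+ r)) <
    (t ^+ 2 * tmin / 2) ^+ r.+1.
  have e1 : (t ^+ 2 * tmin / 2) ^+ r.+1 = t * (tmin / 2) ^+ r.+1 * (t * (t ^+ 2) ^+ r).
    by rewrite -mulrA exprMn [(t ^+ 2) ^+ r.+1]exprS expr2; ring.
  have e2 : (r%:R * (t ^+ 2 * tmax * c) + K0 * t) ^+ r <=
      (r%:R * (tmax * c) + 1) ^+ r * (t ^+ 2) ^+ r.
    rewrite -exprMn lerXn2r ?nnegrE//.
    - by rewrite addr_ge0// !mulr_ge0// ?ltW.
    - by rewrite mulr_ge0 ?addr_ge0 ?mulr_ge0// ?ltW.
    rewrite mulrDl mul1r lerD//; first by rewrite le_eqVlt; apply/orP; left; apply/eqP; ring.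
    by rewrite expr2 ler_pM2r.
  rewrite e1; apply: le_lt_trans (_ : _ <= K0 * (r.+1%:R * (r`!%:R *
      (r%:R * (tmax * c) + 1) ^+ r)) * (t * (t ^+ 2) ^+ r)) _.
    rewrite [leRHS](_ : _ = K0 * t * (r.+1%:R * (r`!%:R *
      ((r%:R * (tmax * c) + 1) ^+ r * (t ^+ 2) ^+ r)))); last by ring.
    by rewrite !ler_wpM2l.
  by rewrite ltr_pM2r// mulr_gt0// exprn_gt0.
move=> /(_ h1 h2 h3 Yb h4 h5 h6 h7 h8 h9 l cl lsort)[H1 H2]; split=> [i j ij|i ri].
  by have := H1 i j ij; rewrite mxE.
by rewrite mulrAC; exact: H2.
Qed.

(** The zero perturbation localizes the eigenvalues of [G] around the same centers, so the triangle
    inequality compares the two spectra rank by rank. *)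
Lemma eigenvalue_deviation (lA lG : 'I_n -> C) :
  char_poly (toC (G + X)) = \prod_(i < n) ('X - (lA i)%:P) ->
  (forall i j : 'I_n, (i <= j)%N -> normc (lA j) <= normc (lA i)) ->
  char_poly (toC G) = \prod_(i < n) ('X - (lG i)%:P) ->
  (forall i j : 'I_n, (i <= j)%N -> normc (lG j) <= normc (lG i)) ->
  (forall i : 'I_n, (i < r)%N -> normc (lA i - lG i) < 2 * K1 * t) /\
  (forall i : 'I_n, (r <= i)%N -> normc (lA i) <= K0 * (1 + 2 * r%:R * c) * t).
Proof.
move=> cA sA cG sG; have [A1 A2] := rescaled_outliers_and_bulk Xb cA sA.
have Zb v : sqnorm (v *m (0 : 'M[R]_n)) <= (K0 * t) ^+ 2 * sqnorm v.
  rewrite mulmx0 {1}/sqnorm big1 => [|x _]; last by rewrite mxE expr0n.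
  exact: mulr_ge0 (sqr_ge0 _) (sqnorm_ge0 v).
rewrite -[G]addr0 in cG; have [G1 _] := rescaled_outliers_and_bulk Zb cG sG.
split=> // i ir; have iE : i = Ordinal ir :> nat by [].
have := ltrD (A1 i _ iE) (G1 i _ iE); rewrite -mulrDl -mulr2n -[K1 *+ 2]mulr_natl.
apply: le_lt_trans; rewrite [X in _ <= _ + X]normcB.
by apply: le_trans (le_normcD _ _); rewrite addrA subrK.
Qed.

End Rescaled.

Require Import Defs.
From mathcomp Require Import all_boot all_order all_algebra.
From mathcomp Require Import all_classical all_reals all_analysis.
From mathcomp Require Import complex.
Import Order.TTheory GRing.Theory Num.Theory.
Import numFieldNormedType.Exports.
Local Open Scope classical_set_scope.
Local Open Scope ring_scope.

(** * The random digraph *)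

Section ConfigurationLaw.
Context (R : realType) d (T : measurableType d) (P : probability T R) (n : nat).
Variables (a : 'I_n -> 'I_n -> {RV P >-> bool}) (p : 'I_n * 'I_n -> R).
Hypothesis indep : mutually_independent (fun e : 'I_n * 'I_n => a e.1 e.2).
Hypothesis ap : forall x y, P [set w | a x y w = true] = (p (x, y))%:E.

(** The adjacency matrix depends on [w] only through this finite-valued map, which turns
    probabilities into finite sums of [bernoulli_weight]. *)
Definition configuration (w : T) : {ffun 'I_n * 'I_n -> bool} :=
  [ffun e => a e.1 e.2 w].

Lemma measurable_edge x y b : measurable [set w | a x y w = b].
Proof. exact: (@measurable_funPTI _ _ _ _ (a x y) [set b]). Qed.

Lemma configuration_setE c :
  [set w | configuration w = c] =
  \bigcap_(e in [set` [set: 'I_n * 'I_n]%SET]) (a e.1 e.2 @^-1` [set c e]).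
Proof.
apply/seteqP; split => [w <- e _|w wc] /=; first by rewrite ffunE.
by apply/ffunP => e; rewrite ffunE; apply: wc; rewrite /= inE.
Qed.

Lemma measurable_configuration c : measurable [set w | configuration w = c].
Proof.
rewrite configuration_setE; apply: fin_bigcap_measurable; first exact: finite_finset.
by move=> e _; exact: measurable_edge.
Qed.

Lemma configuration_prob c :
  P [set w | configuration w = c] = (bernoulli_weight p c)%:E.
Proof.
rewrite configuration_setE indep// /bernoulli_weight (big_morph EFin EFinM erefl).
apply: eq_big => [e|e _]; first by rewrite inE.
have a1 : P [set w | a e.1 e.2 w = true] = (p e)%:E by rewrite ap -surjective_pairing.
have -> : a e.1 e.2 @^-1` [set c e] = [set w | a e.1 e.2 w = c e] by [].
case: (c e) => //.
have -> : [set w | a e.1 e.2 w = false] = ~` [set w | a e.1 e.2 w = true].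
  by apply/seteqP; split => w /=; case: (a e.1 e.2 w).
by rewrite probability_setC ?a1//; exact: measurable_edge.
Qed.

(** A union bound over the configurations; with an inequality the induction can run over any list,
    repetitions included. *)
Lemma configuration_event_le (Q : pred {ffun 'I_n * 'I_n -> bool}) :
  (P [set w | Q (configuration w)] <= (\sum_(c | Q c) bernoulli_weight p c)%:E)%E.
Proof.
suff H (r : seq {ffun 'I_n * 'I_n -> bool}) :
    measurable [set w | configuration w \in r] /\
    (P [set w | configuration w \in r] <= (\sum_(c <- r) bernoulli_weight p c)%:E)%E.
  have [_] := H (enum Q); rewrite big_enum; congr (P _ <= _)%E.
  by apply/seteqP; split => w /=; rewrite mem_enum.
elim: r => [|c r [mr IH]].
  rewrite big_nil (_ : [set w | _] = set0) ?measure0//.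
  by apply/seteqP; split.
have -> : [set w | configuration w \in c :: r] =
    [set w | configuration w = c] `|` [set w | configuration w \in r].
  apply/seteqP; split => w /=; rewrite inE; first by case/orP => [/eqP|]; [left|right].
  by case=> [->|->]; rewrite ?eqxx ?orbT.
have mc := measurable_configuration c; split; first exact: measurableU.
apply: le_trans (measureU2 _ mc mr) _.
rewrite big_cons EFinD; apply: leeD; last exact: IH.
by rewrite -configuration_prob.
Qed.

Lemma expected_bernoulli x y : fine 'E_P[fun w => (a x y w)%:R] = p (x, y).
Proof.
have -> : (fun w => (a x y w)%:R) = \1_[set w | a x y w = true] :> (T -> R).
  apply/funext => w; rewrite indicE; congr (_%:R).
  case E : (a x y w); first by rewrite mem_set.
  by rewrite memNset//= E.
by rewrite expectation_indic ?ap//; exact: measurable_edge.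
Qed.

End ConfigurationLaw.

(** The passage from trace to norm wants exponents that are powers of two; this rounds a real length
    to one at the price of a factor 2. *)
Lemma pow2_between (R : realType) (y : R) : 1 <= y ->
  exists m : nat, y <= 2 ^+ m <= 2 * y.
Proof.
move=> y1; have ex : exists m : nat, y <= 2 ^+ m.
  exists (Num.truncn y).+1; apply: ltW; apply: lt_trans (truncnS_gt y) _.
  by rewrite -natrX ltr_nat ltn_expl.
case: (ex_minnP ex) => m ym mmin; exists m; rewrite ym /=.
case: m ym mmin => [|m] _ mmin; first by rewrite expr0; lra.
rewrite exprS ler_pM2l// leNgt; apply/negP => /ltW /mmin.
by rewrite ltnn.
Qed.

Lemma ler_sum_subpred (R : numDomainType) (I : finType) (A B : pred I) (F : I -> R) :
  (forall i, 0 <= F i) -> (forall i, A i -> B i) ->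
  \sum_(i | A i) F i <= \sum_(i | B i) F i.
Proof.
move=> F0 AB; rewrite [leLHS]big_mkcond [leRHS]big_mkcond.
apply: ler_sum => i _; case: ifP => [/AB->//|_].
by case: ifP.
Qed.

Lemma fin_positive_lower_bound (R : realDomainType) (I : finType) (f : I -> R) :
  (forall i, 0 < f i) -> exists2 m : R, 0 < m & forall i, m <= f i.
Proof.
move=> f0; suff [m m0 H] : exists2 m, 0 < m & forall i, i \in enum I -> m <= f i.
  by exists m => // i; apply: H; rewrite mem_enum.
elim: (enum I) => [|i s [m m0 H]]; first by exists 1.
exists (Num.min m (f i)); first by rewrite lt_min m0 f0.
by move=> j; rewrite inE ge_min => /orP[/eqP->|/H ->//]; rewrite lexx orbT.
Qed.

Lemma centered_norm_tail (R : realType) (n : nat) (p : 'I_n * 'I_n -> R) (q C t y : R) :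
  (0 < n)%N -> (forall e, 0 <= p e <= 1) -> (forall e, p e <= q) ->
  0 < t -> 0 <= C -> 1 <= y -> ln n%:R <= y -> 64 * y ^+ 2 <= t ->
  n%:R * q <= C * t ^+ 2 -> 64 * y ^+ 2 * q <= t ^+ 2 ->
  \sum_(c | ~~ `[< forall v, sqnorm (v *m centered p c) <=
                     ((C + 3) * expR 1 * t) ^+ 2 * sqnorm v >])
    bernoulli_weight p c <= expR (- y).
Proof.
move=> n0 p01 pq t0 C0 y1 ny yt nq yq.
have [m /andP[ym my]] := pow2_between y1.
(* The length satisfies [4 y <= l <= 8 y], whence the constant 64. The factor [e] in [K] makes the
   tail [n e^(-l)], and [l >= 4 y] absorbs [n <= e^y]. *)
pose l := (2 ^ m.+1).*2; pose K := (C + 3) * expR 1.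
have lE : l%:R = 4 * 2 ^+ m :> R by rewrite /l -mul2n natrM expnS natrM natrX; ring.
have K0 : 0 < K by rewrite mulr_gt0 ?expR_gt0//; move: C0; lra.
have l2 : l%:R ^+ 2 <= 64 * y ^+ 2.
  rewrite (_ : 64 * y ^+ 2 = (8 * y) ^+ 2); last by ring.
  have y8 : 0 <= 8 * y by move: y1; lra.
  by rewrite ler_sqr ?nnegrE ?ler0n ?lE//; move: my; lra.
have q0 : 0 <= q.
  by have e0 := Ordinal n0; have /andP[h _] := p01 (e0, e0); exact: le_trans h (pq _).
have tr0 c : 0 <= \tr (altprod (centered p c) l false).
  rewrite /l expnS mul2n gram_trace.
  by apply: sumr_ge0 => x _; apply: sumr_ge0 => z _; exact: sqr_ge0.
have := @altprod_trace_tail R n p p01 q C t K l n0 pq t0 C0 _ _ nq _ tr0 K0.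
have l0 : (0 < l)%N by rewrite /l double_gt0 expn_gt0.
move=> /(_ l0 (le_trans l2 yt) (le_trans (ler_wpM2r q0 l2) yq)) tail.
apply: (@le_trans _ _ (n%:R * ((C + 3) / K) ^+ l)).
  apply: le_trans tail; apply: ler_sum_subpred => [c|c].
    exact: bernoulli_weight_ge0.
  rewrite ltNge; apply: contra => trc; apply/asboolP => v.
  by apply: sqnorm_mul_le_trace trc; rewrite mulr_ge0 ?ltW.
have -> : (C + 3) / K = expR (- 1).
  rewrite /K expRN; field; rewrite gt_eqF ?expR_gt0//=.
  by rewrite gt_eqF//; move: C0; lra.
have -> : n%:R = expR (ln n%:R) :> R by rewrite lnK// posrE ltr0n.
rewrite -expRM_natl -expRD ler_expR lE; move: ny ym y1; lra.
Qed.

(** * The deviation bound at a fixed size *)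

Section FixedSize.
Context (R : realType) (n r : nat) (theta : 'I_r -> R) (s : R)
  (vp vm : 'I_r -> 'cV[R]_n).
Variables (tmin tmax gap c : R).
Hypotheses (n0 : (0 < n)%N) (r0 : (0 < r)%N).
Hypothesis s0 : 0 < s.
Hypothesis vpvm : biorthogonal vp vm.
Hypothesis vp1 : forall i, norm2 (vp i) = 1.
Hypothesis c0 : 0 <= c.
Hypothesis vpc : forall i x, `|Num.sqrt n%:R * vp i x 0| <= c.
Hypothesis vmc : forall i x, `|Num.sqrt n%:R * vm i x 0| <= c.
Hypothesis tmin0 : 0 < tmin.
Hypothesis theta_bd : forall j, tmin <= theta j <= tmax.
Hypothesis theta_gap : forall i j : 'I_r, (i < j)%N -> theta j + gap <= theta i.

Let t := Num.sqrt s.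
Let Vp : 'M[R]_(n, r) := \matrix_(x, j) vp j x 0.
Let Vm : 'M[R]_(r, n) := \matrix_(j, x) vm j x 0.
Let p (e : 'I_n * 'I_n) := edge_prob theta s vp vm e.1 e.2.
Let C1 := r%:R * tmax * c ^+ 2.

Let t2E : t ^+ 2 = s. Proof. by rewrite sqr_sqrtr// ltW. Qed.
Let nR0 : 0 < n%:R :> R. Proof. by rewrite ltr0n. Qed.

Let tmax0 : 0 < tmax.
Proof. by have /andP[h1 h2] := theta_bd (Ordinal r0); apply: lt_le_trans tmin0 (le_trans h1 h2). Qed.

Let VmVp : Vm *m Vp = 1%:M.
Proof.
apply/matrixP => i j; have := vpvm j i; rewrite !mxE => e.
by rewrite eq_sym -e; apply: eq_bigr => x _; rewrite !mxE mulrC.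
Qed.

Let Vp1 j : \sum_x Vp x j ^+ 2 = 1.
Proof.
have S0 : 0 <= \sum_(x < n) vp j x 0 ^+ 2 by apply: sumr_ge0 => x _; exact: sqr_ge0.
under eq_bigr do rewrite mxE.
by rewrite -[LHS]sqr_sqrtr// -[Num.sqrt _]/(norm2 (vp j)) vp1 expr1n.
Qed.

Let Vmc j : \sum_x Vm j x ^+ 2 <= c ^+ 2.
Proof.
rewrite -(ler_pM2l nR0) mulr_sumr.
apply: (@le_trans _ _ (\sum_(x < n) c ^+ 2)); last first.
  by rewrite sumr_const card_ord -[leLHS]mulr_natl.
apply: ler_sum => x _; rewrite mxE -{1}(@sqr_sqrtr _ n%:R) ?ler0n// -exprMn -real_normK ?num_real//.
by rewrite ler_sqr ?nnegrE.
Qed.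

Let lowrankE x y : lowrank Vp Vm (\row_j (t ^+ 2 * theta j)) x y = p (x, y).
Proof.
rewrite /lowrank mul_mx_diag mxE /p /edge_prob mulr_sumr; apply: eq_bigr => j _.
by rewrite !mxE t2E; ring.
Qed.

(** Entries of the [vp] and [vm] are at most [c / sqrt n], so a product of two is at most
    [c^2 / n]. *)
Let p_le e : p e <= C1 * s / n%:R.
Proof.
rewrite /p /edge_prob ler_pdivlMr// -mulrA [leRHS]mulrC ler_pM2l// mulr_suml.
apply: (@le_trans _ _ (\sum_(j < r) tmax * c ^+ 2)); last first.
  by rewrite sumr_const card_ord -[leLHS]mulr_natl mulrA.
apply: ler_sum => j _; have /andP[h1 h2] := theta_bd j.
apply: (@le_trans _ _ (theta j * c ^+ 2)); last by rewrite ler_wpM2r ?sqr_ge0.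
rewrite -!mulrA ler_wpM2l ?(le_trans (ltW tmin0))//.
apply: le_trans (ler_norm _) _.
rewrite -{1}(@sqr_sqrtr _ n%:R) ?ler0n//.
rewrite (_ : _ * _ = (Num.sqrt n%:R * vp j e.1 0) * (Num.sqrt n%:R * vm j e.2 0)); last by ring.
by rewrite normrM expr2 ler_pM.
Qed.

Variables (K1 : R).
Let K0 := (C1 + 3) * expR 1.
Hypothesis K1E : 4 * (K0 * c * r%:R * tmax) < K1 * tmin.
Hypothesis t1 : K0 < t * (tmin / 4).
Hypothesis t2 : K1 <= t * (tmin / 2).
Hypothesis t3 : 2 * K1 <= t * gap.
Hypothesis t4 : K0 * (1 + 2 * r%:R * c) < t * (tmin / 2).
Hypothesis t5 : K0 <= t.
Hypothesis t6 : K0 * (r.+1%:R * (r`!%:R * (r%:R * (tmax * c) + 1) ^+ r)) <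
  t * (tmin / 2) ^+ r.+1.
Variable y : R.
Hypotheses (y1 : 1 <= y) (ny : ln n%:R <= y) (yt : 64 * y ^+ 2 <= t).
Hypothesis yn : 64 * C1 * y ^+ 2 <= n%:R.

(** When the noise has norm at most [K0 * t], the deterministic bounds apply; the threshold adds the
    constants of the outliers and of the bulk, so it strictly exceeds both maxima. The complementary
    event has the tail of [centered_norm_tail]. *)
Lemma spectral_deviation_tail d (T : measurableType d) (P : probability T R)
    (a : 'I_n -> 'I_n -> {RV P >-> bool}) (lam : 'M[R[i]]_n -> 'I_n -> R[i]) :
  mutually_independent (fun e : 'I_n * 'I_n => a e.1 e.2) ->
  (forall x y, P [set w | a x y w = true] = (edge_prob theta s vp vm x y)%:E) ->
  (forall x y, 0 <= edge_prob theta s vp vm x y <= 1) ->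
  (forall M, eigenvalues_ordered M (lam M)) ->
  (P [set w | ((2 * K1 + K0 * (1 + 2 * r%:R * c)) * t <=
       spectral_deviation r lam (adjacency a w) (expected_adjacency a))%R] <=
   (expR (- y))%:E)%E.
Proof.
move=> indep ap p01 lamP.
have t0 : 0 < t by rewrite sqrtr_gt0.
have C10 : 0 <= C1 by rewrite /C1 !mulr_ge0 ?sqr_ge0 ?(ltW tmax0).
have K00 : 0 < K0 by rewrite mulr_gt0 ?expR_gt0//; move: C10; lra.
have K10 : 0 < K1.
  have h : 0 <= 4 * (K0 * c * r%:R * tmax).
    by rewrite mulr_ge0// mulr_ge0 ?(ltW tmax0)// mulr_ge0// mulr_ge0// ltW.
  by have := le_lt_trans h K1E; rewrite pmulr_lgt0.
have bulk0 : 0 <= K0 * (1 + 2 * r%:R * c).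
  apply: mulr_ge0; first exact: ltW.
  by rewrite addr_ge0// mulr_ge0// mulr_ge0.
pose G := lowrank Vp Vm (\row_j (t ^+ 2 * theta j)).
have EG : expected_adjacency a = toC G.
  apply/matrixP => x z; rewrite [LHS]mxE [RHS]mxE lowrankE.
  by rewrite (@expected_bernoulli _ _ _ _ _ a p).
have AG w : adjacency a w = toC (G + centered p (configuration a w)).
  apply/matrixP => x z; rewrite [LHS]mxE [RHS]mxE [X in _ = (X)%:C%C]mxE lowrankE.
  by rewrite mxE ffunE /= addrCA subrr addr0 rmorph_nat.
pose Q (cf : {ffun 'I_n * 'I_n -> bool}) :=
  (2 * K1 + K0 * (1 + 2 * r%:R * c)) * t <=
    spectral_deviation r lam (toC (G + centered p cf)) (toC G).
have -> : [set w | ((2 * K1 + K0 * (1 + 2 * r%:R * c)) * t <=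
    spectral_deviation r lam (adjacency a w) (expected_adjacency a))%R] =
    [set w | Q (configuration a w)].
  by apply/seteqP; split => w; rewrite /Q /= EG AG.
have ap' x z : P [set w | a x z w = true] = (p (x, z))%:E by exact: ap.
apply: le_trans (configuration_event_le indep ap' Q) _; rewrite lee_fin.
have p01' e : 0 <= p e <= 1 by exact: p01.
have nq : n%:R * (C1 * s / n%:R) <= C1 * t ^+ 2.
  by rewrite t2E mulrCA divff ?gt_eqF// mulr1.
have yq : 64 * y ^+ 2 * (C1 * s / n%:R) <= t ^+ 2.
  rewrite mulrA ler_pdivrMr// t2E (_ : _ * (C1 * s) = s * (64 * C1 * y ^+ 2)); last by ring.
  by rewrite ler_pM2l.
apply: le_trans (centered_norm_tail n0 p01' p_le t0 C10 y1 ny yt nq yq).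
apply: ler_sum_subpred => [cf|cf]; first exact: bernoulli_weight_ge0.
apply: contraL => /asboolP Xb; rewrite /Q -ltNge.
have [cA sA] := lamP (toC (G + centered p cf)); have [cG sG] := lamP (toC G).
have [D1 D2] := eigenvalue_deviation VmVp Vp1 c0 Vmc tmin0 theta_bd theta_gap K00 K1E Xb
  t0 t1 t2 t3 t4 t5 t6 r0 cA sA cG sG.
have K0t : 0 < (2 * K1 + K0 * (1 + 2 * r%:R * c)) * t.
  by rewrite mulr_gt0//; move: K10 bulk0; lra.
rewrite /spectral_deviation gt_max; apply/andP; split.
  apply/bigmax_ltP; split=> // i ir; apply: lt_le_trans (D1 i ir) _.
  by rewrite ler_pM2r//; move: bulk0; lra.
apply/bigmax_ltP; split=> // i ir; apply: le_lt_trans (D2 i ir) _.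
by rewrite ltr_pM2r//; move: K10; lra.
Qed.

End FixedSize.

(** * Choice of the constants and the limit of large [n] *)

Lemma growth_near (R : realType) (s : nat -> R) (xi D : R) : 0 < D ->
  (\forall n \near \oo, 0 < s n) ->
  negligible_wrt (fun n => ln n%:R `^ xi) s ->
  negligible_wrt s (fun n => n%:R) ->
  \forall n \near \oo, [/\ 1 <= ln (n%:R : R), D * ln n%:R `^ xi <= s n & s n <= n%:R].
Proof.
move=> D0 s0 h1 h2.
have D1 : 0 < D^-1 by rewrite invr_gt0.
near=> n.
have sn0 : 0 < s n by near: n.
have nexp : expR 1 <= n%:R :> R by near: n; exact: nbhs_infty_ger.
have n0 : 0 < n%:R :> R by apply: lt_le_trans nexp; exact: expR_gt0.
split.
- by rewrite -[leLHS]expRK ler_ln ?posrE ?expR_gt0.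
- have : `|ln n%:R `^ xi / s n| < D^-1 by near: n; exact: cvgr0_norm_lt.
  move=> /(le_lt_trans (ler_norm _)); rewrite ltr_pdivrMr// => /ltW.
  by rewrite -ler_pdivlMl ?invr_gt0// invrK.
have : `|s n / n%:R| < 1 by near: n; exact: cvgr0_norm_lt.
move=> /(le_lt_trans (ler_norm _)); rewrite ltr_pdivrMr// mul1r; exact: ltW.
Unshelve. all: by end_near. Qed.

Lemma lt_one_add_sum (R : realDomainType) (s : seq R) (x : R) :
  (forall z, z \in s -> 0 <= z) -> x \in s -> x < 1 + \sum_(z <- s) z.
Proof.
move=> s0 xs; rewrite (big_rem x)//= addrCA ltrDl ltr_pwDl//.
by rewrite big_seq; apply: sumr_ge0 => z /mem_rem /s0.
Qed.

Unset Implicit Arguments.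
Set Strict Implicit.

Theorem theorem2p15 (R : realType) (r : nat) (theta : 'I_r -> R)
    (s : nat -> R) (vp vm : forall n, 'I_r -> 'cV[R]_n)
    (d : nat -> measure_display) (T : forall n, measurableType (d n))
    (P : forall n, probability (T n) R)
    (a : forall n, 'I_n -> 'I_n -> {RV (P n) >-> bool})
    (lam : forall n, 'M[R[i]]_n -> 'I_n -> R[i]) :
  (1 <= r)%N ->
  (forall i j : 'I_r, (i < j)%N -> theta j < theta i) ->
  (forall i : 'I_r, 0 < theta i) ->
  rank_r_digraph theta s vp vm a ->
  growth_assumption s ->
  profile_assumption theta s vp vm ->
  (forall n (M : 'M[R[i]]_n), eigenvalues_ordered M (lam n M)) ->
  exists K eta : R, [/\ 0 < K, 1 < eta &
    \forall n \near \oo,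
      (P n [set w | (K * Num.sqrt (s n) <=
          spectral_deviation r (lam n)
            (adjacency (a n) w) (expected_adjacency (a n)))%R]
       <= (expR (- (ln n%:R `^ eta)))%:E)%E].
Proof.
move=> r0 theta_dec theta0 model [xi [xi4 gs1 gs2]] [[Cb HC] p01 _] lamP.
have [tmin tmin0 tminP] := fin_positive_lower_bound theta0.
pose tmax := \sum_j theta j.
have theta_bd j : tmin <= theta j <= tmax.
  rewrite tminP /tmax (bigD1 j)//= lerDl.
  by apply: sumr_ge0 => i _; exact: ltW.
have tmax0 : 0 < tmax.
  by have /andP[h1 h2] := theta_bd (Ordinal r0); apply: lt_le_trans tmin0 (le_trans h1 h2).
have [gap gap0 gapP] : exists2 gap : R, 0 < gap & forall i j : 'I_r, (i < j)%N ->
    theta j + gap <= theta i.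
  have [|g g0 gP] := @fin_positive_lower_bound R _
    (fun e : 'I_r * 'I_r => if (e.1 < e.2)%N then theta e.1 - theta e.2 else 1).
    by move=> [i j] /=; case: ifP => // /theta_dec; rewrite subr_gt0.
  by exists g => // i j ij; have := gP (i, j); rewrite /= ij lerBrDl.
pose c := `|Cb|; have c0 : 0 <= c by exact: normr_ge0.
pose C1 := r%:R * tmax * c ^+ 2; pose K0 := (C1 + 3) * expR 1.
have C10 : 0 <= C1 by rewrite /C1 mulr_ge0 ?sqr_ge0// mulr_ge0// ltW.
have K00 : 0 < K0 by rewrite mulr_gt0 ?expR_gt0//; move: C10; lra.
(* The quotient is the equality case of [K1E]; the added 1 makes it strict. *)
pose K1 := 4 * (K0 * c * r%:R * tmax) / tmin + 1.
have E0 : 0 <= 4 * (K0 * c * r%:R * tmax).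
  by rewrite mulr_ge0// mulr_ge0 ?(ltW tmax0)// mulr_ge0// mulr_ge0// ltW.
have K10 : 0 < K1 by rewrite ltr_pwDr// divr_ge0// ltW.
have K1E : 4 * (K0 * c * r%:R * tmax) < K1 * tmin.
  rewrite -ltr_pdivrMr// /K1; set z := _ / tmin; lra.
pose E4 := K0 * (1 + 2 * r%:R * c).
pose E6 := K0 * (r.+1%:R * (r`!%:R * (r%:R * (tmax * c) + 1) ^+ r)).
have E40 : 0 <= E4.
  apply: mulr_ge0; first exact: ltW.
  by rewrite addr_ge0// mulr_ge0// mulr_ge0.
have E60 : 0 <= E6.
  apply: mulr_ge0; first exact: ltW.
  rewrite mulr_ge0// mulr_ge0// exprn_ge0// addr_ge0// mulr_ge0// mulr_ge0//.
  exact: ltW.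
(* The thresholds on [t] in the conditions of the fixed-size bound; for [t5] the threshold is [K0]
   itself. Below, [M] exceeds them all. *)
pose f1 := K0 / (tmin / 4); pose f2 := K1 / (tmin / 2); pose f3 := 2 * K1 / gap.
pose f4 := E4 / (tmin / 2); pose f6 := E6 / (tmin / 2) ^+ r.+1.
have m2 : 0 < tmin / 2 by rewrite divr_gt0.
have m4 : 0 < tmin / 4 by rewrite divr_gt0.
have f10 : 0 <= f1 by rewrite divr_ge0// ltW.
have f20 : 0 <= f2 by rewrite divr_ge0// ltW.
have f30 : 0 <= f3 by rewrite divr_ge0// ?mulr_ge0// ltW.
have f40 : 0 <= f4 by rewrite divr_ge0// ltW.
have f60 : 0 <= f6 by rewrite divr_ge0// exprn_ge0// ltW.
pose fs := [:: f1; f2; f3; f4; K0; f6]; pose M := 1 + \sum_(z <- fs) z.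
have fs0 z : z \in fs -> 0 <= z.
  by rewrite !inE => /orP[|/orP[|/orP[|/orP[|/orP[]]]]] /eqP-> //; exact: ltW.
have M0 : 0 < M.
  by rewrite ltr_pwDl// big_seq; apply: sumr_ge0.
have fM z : z \in fs -> z < M by exact: lt_one_add_sum.
(* From [s >= D * y ^+ 4] the three terms yield in turn [64 * y ^+ 2 <= t], [64 * C1 * y ^+ 2 <= n]
   (as [s <= n]) and [M <= t]. *)
pose D := 64 ^+ 2 + 64 * C1 + M ^+ 2.
have C64 : 0 <= 64 * C1 by rewrite mulr_ge0.
have D64s : 64 ^+ 2 <= D by rewrite /D -addrA lerDl addr_ge0 ?sqr_ge0.
have D64 : 64 * C1 <= D by rewrite /D addrAC lerDr addr_ge0 ?sqr_ge0.
have DM2 : M ^+ 2 <= D by rewrite /D lerDr addr_ge0.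
have D0 : 0 < D by apply: lt_le_trans D64s; rewrite exprn_gt0.
(* The walk length is of order [y = (ln n)^eta] and its square must be bounded by the square root of
   [s]; so [y ^+ 4] is matched with [(ln n)^xi], and [eta = xi / 4] exceeds 1 because [xi > 4]. *)
have eta1 : 1 < xi / 4 by rewrite ltr_pdivlMr// mul1r.
exists (2 * K1 + E4), (xi / 4); split.
- by rewrite ltr_pwDl// mulr_gt0.
- exact: eta1.
have sP : \forall n \near \oo, 0 < s n.
  near=> n; have rn : (r <= n)%N by near: n; exact: nbhs_infty_ge.
  by have [] := model n rn.
near=> n.
have rn : (r <= n)%N by near: n; exact: nbhs_infty_ge.
have n0 : (0 < n)%N by exact: leq_trans rn.
have [s0 bio vp1 indep ap] := model n rn.
have [ln1 sD sn] : [/\ 1 <= ln (n%:R : R), D * ln n%:R `^ xi <= s n & s n <= n%:R].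
  by near: n; exact: growth_near D0 sP gs1 gs2.
pose y : R := ln n%:R `^ (xi / 4); pose t := Num.sqrt (s n).
have L0 : 0 <= ln (n%:R : R) by exact: le_trans ln1.
have y4 : ln (n%:R : R) `^ xi = y ^+ 4.
  by rewrite -powR_mulrn ?powR_ge0// -powRrM mulfVK.
have ny : ln n%:R <= y.
  by rewrite -[leLHS]powRr1// ler_powR// ltW.
have y1 : 1 <= y by exact: le_trans ny.
have y41 : 1 <= y ^+ 4 by rewrite exprn_ege1.
have y2 : y ^+ 2 <= y ^+ 4 by rewrite ler_weXn2l.
have t0 : 0 <= t by exact: sqrtr_ge0.
have t2E : t ^+ 2 = s n by rewrite sqr_sqrtr// ltW.
have sD' : D * y ^+ 4 <= s n by rewrite -y4.
have DM : M <= t.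
  rewrite -ler_sqr ?nnegrE ?(ltW M0)// t2E; apply: le_trans sD'.
  apply: (@le_trans _ _ (D * 1)); last by rewrite ler_pM2l.
  by rewrite mulr1.
have yt : 64 * y ^+ 2 <= t.
  have h0 : 0 <= 64 * y ^+ 2 by rewrite mulr_ge0 ?sqr_ge0.
  rewrite -ler_sqr ?nnegrE// t2E; apply: le_trans sD'.
  rewrite exprMn -[(y ^+ 2) ^+ 2]exprM.
  by rewrite ler_wpM2r ?exprn_ge0 ?(le_trans ler01).
have yn : 64 * C1 * y ^+ 2 <= n%:R.
  apply: le_trans sn; apply: le_trans sD'.
  by apply: ler_pM => //; exact: sqr_ge0.
have ft (x z : R) : 0 < z -> x / z \in fs -> x < t * z.
  by move=> z0 /fM xM; rewrite -ltr_pdivrMr//; exact: lt_le_trans DM.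
have vpc i x : `|Num.sqrt n%:R * vp n i x 0| <= c.
  by have [h _] := HC n rn i x; exact: le_trans (ler_norm _).
have vmc i x : `|Num.sqrt n%:R * vm n i x 0| <= c.
  by have [_ h] := HC n rn i x; exact: le_trans (ler_norm _).
have t1 : K0 < t * (tmin / 4) by apply: ft; rewrite ?inE ?eqxx.
have t2 : K1 <= t * (tmin / 2) by apply/ltW/ft; rewrite ?inE ?eqxx ?orbT.
have t3 : 2 * K1 <= t * gap by apply/ltW/ft; rewrite ?inE ?eqxx ?orbT.
have t4 : E4 < t * (tmin / 2) by apply: ft; rewrite ?inE ?eqxx ?orbT.
have t5 : K0 <= t by apply: ltW; apply: lt_le_trans DM; apply: fM; rewrite !inE eqxx ?orbT.
have t6 : E6 < t * (tmin / 2) ^+ r.+1.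
  by apply: ft; rewrite ?exprn_gt0// !inE eqxx ?orbT.
exact: (spectral_deviation_tail n0 r0 s0 bio vp1 c0 vpc vmc tmin0 theta_bd gapP K1E
  t1 t2 t3 t4 t5 t6 y1 ny yt yn indep ap (p01 n rn) (lamP n)).
Unshelve. all: by end_near. Qed.
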